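(* Let $(X,d)$, $\mathcal{B}$, $m$, $C$, $\lambda$, $L_C$ and $\mathcal{T}_X$ be as in the context, and let $f\in\mathcal{S}_0(X)$. Suppose that \[\kappa:=\lim_{k\to+\infty}\frac{\lambda(B_k(x))}{C(B_k(x))}\] exists, belongs to $(0,+\infty)$, and is independent of $x\in X$, with convergence uniform on compact subsets of $X$. Put \[W(B,B')=\frac1\kappa\,\frac{m(B)\lambda(B)\lambda(B')}{C(B)},\] where $B'$ is the unique immediate super-ball of $B$, and consider the problem \[\begin{cases}\Delta_W\varphi(v_B)=0,& v_B\in\mathcal{T}_X;\\ \varphi|_{\partial\mathcal{T}_X}(x)=f(x),& x\in X;\\ \varphi(\infty)=0.\end{cases}\] Then: 1. The problem has a unique solution in the canonical class of harmonic functions with an $L^2(X,m)$ trace and with flux $\Phi(B)=W(B,B')(\varphi(v_B)-\varphi(v_{B'}))$ of the form $\Phi(B)=\int_Bg_\varphi(y)\,dm(y)$ for all $B\in\mathcal{B}$, for some $g_\varphi\in\mathcal{S}_0(X)$. For this solution, $g_\varphi=\kappa^{-1}L_Cf$. 2. The deformed normal derivative \[\partial_n^{(W)}\varphi(x)=\lim_{k\to+\infty}\frac{W(B_k(x),B_{k-1}(x))}{m(B_k(x))}\bigl(f(x)-\varphi(v_{B_{k-1}(x)})\bigr)\] exists as a limit in $L^2(X,m)$, and $\partial_n^{(W)}\varphi=L_Cf$ in $L^2(X,m)$. 3. The solution satisfies the energy identity \[\frac12\sum_{\substack{v_A,v_B\in\mathcal{T}_X\\ v_A\sim v_B}}|\varphi(v_A)-\varphi(v_B)|^2\,W(A,B)=\frac1\kappa\int_Xf(x)L_Cf(x)\,dm(x),\]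 the sum being over ordered pairs of adjacent vertices.
   Context: Space. $(X,d)$ is a noncompact, locally compact, separable, perfect ultrametric space; $\mathcal{B}$ is a countable basis of nonempty compact open balls; $m$ is a non-atomic Borel Radon measure of full support with $m(X)=+\infty$ and $0<m(B)<+\infty$ for all $B\in\mathcal{B}$. Every $B\in\mathcal{B}$ has a unique immediate strict super-ball $B'\in\mathcal{B}$; every ball in $\mathcal{B}$ is the disjoint union of finitely many (at least two) maximal proper sub-balls in $\mathcal{B}$, and $\mathrm{sub}(B)$ denotes the collection of those of $B$ (so $A\in\mathrm{sub}(A')$). Any two balls in $\mathcal{B}$ are contained in a common ball of $\mathcal{B}$, reachable from either by finitely many iterations of $B\mapsto B'$; for each $B$ the union of its successive super-balls is $X$; along every infinite strictly descending chain of successive sub-balls the diameters tend to $0$. Tree. $\mathcal{T}_X$ has a vertex $v_B$ for each $B\in\mathcal{B}$ and an undirected edge between $v_B$ and $v_{B'}$ for each $B$; it is a connected, locally finite tree. Its descending ends are the points of $X$; its common ascending end is denoted $\infty$; $\partial\mathcal{T}_X=X\cup\{\infty\}$. A height function $h:\mathcal{B}\to\mathbb{Z}$ with $h(B)-h(B')=1$ is fixed; balls of each height $k$ partition $X$, and $B_k(x)$ denotes the ball of height $k$ containing $x$, so $B_k(x)'=B_{k-1}(x)$, $\bigcap_kB_k(x)=\{x\}$, $\bigcup_kB_k(x)=X$. Functions. $\mathcal{S}(X)$ is the space of real-valued locally constant compactly supported functions on $X$, and $\mathcal{S}_0(X)=\{f\in\mathcal{S}(X):\int_Xf\,dm=0\}$.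 Hierarchical Laplacian. $C:\mathcal{B}\to(0,+\infty)$ is such that $\lambda(B):=\sum_{D\in\mathcal{B},D\supseteq B}C(D)<+\infty$ for every $B\in\mathcal{B}$ and $\lambda(B_k(x))\to+\infty$ as $k\to+\infty$ for every $x\in X$. For $f\in\mathcal{S}(X)$, \[L_Cf(x)=\sum_{B\in\mathcal{B},\,B\ni x}C(B)\Bigl(f(x)-\frac1{m(B)}\int_Bf\,dm\Bigr).\] Extension problem. $W$ is symmetric on edges, $W(B',B)=W(B,B')$, and $\Delta_W\varphi(v_B)=W(B,B')(\varphi(v_{B'})-\varphi(v_B))+\sum_{A\in\mathrm{sub}(B)}W(A,B)(\varphi(v_A)-\varphi(v_B))$; $\varphi$ is harmonic if $\Delta_W\varphi=0$ at every vertex. The boundary condition $\varphi|_{\partial\mathcal{T}_X}=f$ on $X$ means that $x\mapsto\varphi(v_{B_k(x)})$ converges to $f$ in $L^2(X,m)$ as $k\to+\infty$; $\varphi(\infty)=0$ means $\varphi(v_{B_k(x)})\to0$ as $k\to-\infty$. *)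

(* Defs.v *)
From HB Require Import structures.
From mathcomp Require Import all_boot all_order all_algebra.
From mathcomp Require Import all_classical all_reals all_analysis.

Set Implicit Arguments.
Unset Strict Implicit.
Unset Printing Implicit Defensive.

Import Order.TTheory GRing.Theory Num.Theory.
Import numFieldNormedType.Exports.

Local Open Scope classical_set_scope.
Local Open Scope ring_scope.

(* Sigma-algebras are only available on pointed types; the space considered
   here is nonempty anyway, since its total mass is infinite. *)
#[short(type="pmetricType")]
HB.structure Definition PointedMetric (K : numDomainType) :=
  {T of Metric K T & isPointed T}.

Notation borel X := (g_sigma_algebraType (@open X)).

Section Space.
Context {R : realType} {X : pmetricType R}.

Definition ultrametric :=
  forall x y z : X, mdist x z <= Num.max (mdist x y) (mdist y z).

Definition separable := exists2 D : set X, countable D & dense D.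

Definition is_metric_ball (B : set X) := exists (x : X) (r : R), 0 < r /\
  (B = [set y | mdist x y < r] \/ B = [set y | mdist x y <= r]).

Definition diameter (A : set X) : R :=
  sup [set mdist p.1 p.2 | p in A `*` A].

Variable m : {measure set (borel X) -> \bar R}.

Definition radon :=
  [/\ forall K : set X, compact K -> (m K < +oo)%E,
      forall A : set (borel X), measurable A ->
        m A = ereal_inf [set m U | U in [set U : set X | open U /\ A `<=` U]]
    & forall U : set X, open U ->
        m U = ereal_sup [set m K | K in [set K : set X | compact K /\ K `<=` U]]].

Definition non_atomic := forall A : set (borel X), measurable A ->
  (0 < m A)%E ->
  exists B : set (borel X),
    [/\ measurable B, B `<=` A, (0 < m B)%E & (m B < m A)%E].

Definition full_support := forall U : set X, open U -> U !=set0 -> (0 < m U)%E.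

Definition locally_constant (f : X -> R) :=
  forall x, \forall y \near x, f y = f x.

Definition compactly_supported (f : X -> R) :=
  compact (closure [set x | f x != 0]).

Definition SX (f : X -> R) := locally_constant f /\ compactly_supported f.

Definition SX0 (f : X -> R) := SX f /\ \int[m]_x f x = 0.

Definition average (f : X -> R) (B : set X) : R :=
  (fine (m B))^-1 * \int[m]_(y in B) f y.

Definition L2 (f : X -> R) := f \in Lfun m 2%:E.

Definition cvgL2 (u : nat -> X -> R) (f : X -> R) :=
  [/\ \forall n \near \oo, L2 (u n), L2 f &
      ('N[m]_2%:E[EFin \o (u n \- f)%R])%E @[n --> \oo] --> 0%E].

End Space.

(* Sum of a real family over a set of indices, meaningful when the family is
   absolutely summable; [esum] itself is only meant for nonnegative terms. *)
Definition setsum {R : realType} {I : choiceType} (S : set I) (a : I -> R) : R :=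
  fine (\esum_(i in S) (a^\+ i)%:E - \esum_(i in S) (a^\- i)%:E)%E.

(* The vertices of the tree are the balls themselves. Functions on vertices are
   functions on [set X] of which only the values at elements of BB matter. The
   default value [set0] of [xget] below is never reached for balls of a
   [ball_hierarchy]. *)
Section Tree.
Context {R : realType} {X : pmetricType R}.
Variable BB : set (set X).

(* [covers A B] means both that A is a maximal proper sub-ball of B and that B
   is an immediate strict super-ball of A. *)
Definition covers (A B : set X) :=
  [/\ BB A, BB B, A `<` B & forall E, BB E -> A `<` E -> E `<=` B -> E = B].

Definition sub (B : set X) : set (set X) := [set A | covers A B].

Definition superball (B : set X) : set X := xget set0 [set D | covers B D].

Definition adjacent_balls (A B : set X) :=
  [/\ BB A, BB B & B = superball A \/ A = superball B].

Variable h : set X -> int.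

(* Limits as k tends to plus or minus infinity over the integers are taken
   along k = n and k = - n, with n a natural number. *)
Definition ballat (k : int) (x : X) : set X :=
  xget set0 [set B | [/\ BB B, h B = k & B x]].

Record ball_hierarchy (m : {measure set (borel X) -> \bar R}) : Prop := {
  balls_countable : countable BB ;
  balls_basis : basis BB ;
  balls_are_balls : forall B, BB B ->
    [/\ B !=set0, compact B, open B & is_metric_ball B] ;
  balls_measure : forall B, BB B -> (0 < m B < +oo)%E ;
  balls_super : forall B, BB B -> exists! D, covers B D ;
  balls_sub : forall B, BB B ->
    [/\ finite_set (sub B),
        exists A1 A2, [/\ sub B A1, sub B A2 & A1 <> A2],
        trivIset (sub B) id
      & \bigcup_(A in sub B) A = B] ;
  balls_common : forall A B, BB A -> BB B -> exists D,
    [/\ BB D, A `<=` D, B `<=` D,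
        exists n, D = iter n superball A
      & exists n, D = iter n superball B] ;
  balls_exhaust : forall B, BB B ->
    \bigcup_n iter n superball B = [set: X] ;
  balls_shrink : forall A : nat -> set X,
    BB (A 0%N) -> (forall n, sub (A n) (A n.+1)) ->
    diameter (A n) @[n --> \oo] --> (0 : R) ;
  height_step : forall B, BB B -> h B - h (superball B) = 1 ;
  height_partition : forall (k : int) (x : X),
    exists! B, [/\ BB B, h B = k & B x]
}.

Variable C : set X -> R.

Definition elambda (B : set X) : \bar R :=
  (\esum_(D in [set D | BB D /\ B `<=` D]) (C D)%:E)%E.

Definition lambda (B : set X) : R := fine (elambda B).

Definition hierarchical_rates :=
  [/\ forall B, BB B -> 0 < C B,
      forall B, BB B -> (elambda B < +oo)%E
    & forall x, lambda (ballat n%:Z x) @[n --> \oo] --> +oo].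

Definition rate_limit (kappa : R) :=
  let q := fun (n : nat) (x : X) =>
    lambda (ballat n%:Z x) / C (ballat n%:Z x) in
  (forall x, q n x @[n --> \oo] --> kappa) /\
  (forall K : set X, compact K -> {uniform K, q @ \oo --> cst kappa}).

Variable m : {measure set (borel X) -> \bar R}.

Definition hierarchical_laplacian (f : X -> R) (x : X) : R :=
  setsum [set B | BB B /\ B x] (fun B => C B * (f x - average m f B)).

Variable W : set X -> set X -> R.

Definition is_edge_weight (kappa : R) := forall B, BB B ->
  W B (superball B) =
    kappa^-1 * (fine (m B) * lambda B * lambda (superball B) / C B) /\
  W (superball B) B = W B (superball B).

Definition tree_laplacian (phi : set X -> R) (B : set X) : R :=
  W B (superball B) * (phi (superball B) - phi B) +
  \sum_(A \in sub B) W A B * (phi A - phi B).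

Definition harmonic (phi : set X -> R) :=
  forall B, BB B -> tree_laplacian phi B = 0.

Definition trace (phi : set X -> R) (f : X -> R) :=
  cvgL2 m (fun n x => phi (ballat n%:Z x)) f.

Definition vanishes_at_infinity (phi : set X -> R) :=
  forall x, phi (ballat (- n%:Z) x) @[n --> \oo] --> (0 : R).

Definition extension_problem (f : X -> R) (phi : set X -> R) :=
  [/\ harmonic phi, trace phi f & vanishes_at_infinity phi].

Definition flux (phi : set X -> R) (B : set X) : R :=
  W B (superball B) * (phi B - phi (superball B)).

Definition flux_density (phi : set X -> R) (g : X -> R) :=
  SX0 m g /\ forall B, BB B -> flux phi B = \int[m]_(y in B) g y.

Definition canonical_class (phi : set X -> R) :=
  [/\ harmonic phi, exists t, trace phi t & exists g, flux_density phi g].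

Definition canonical_solution (f : X -> R) (phi : set X -> R) :=
  canonical_class phi /\ extension_problem f phi.

Definition normal_quotient (f : X -> R) (phi : set X -> R) (k : int) (x : X) :=
  W (ballat k x) (ballat (k - 1) x) / fine (m (ballat k x)) *
  (f x - phi (ballat (k - 1) x)).

Definition energy (phi : set X -> R) : \bar R :=
  ((2^-1)%:E * \esum_(e in [set e | adjacent_balls e.1 e.2])
     (`|phi e.1 - phi e.2| ^+ 2 * W e.1 e.2)%:E)%E.

End Tree.

(* Main.v *)
(* Write [B'] for the super-ball of [B], [a B] for the average of [f] over [B]
   and [b B] for the average of [L f]. Since [C B = lambda B - lambda B'], an
   Abel summation over the balls containing a point gives the martingale
   identity [b B - b B' = lambda B' * (a B - a B')]. For the weight [W] this
   makes [phi B := a B - b B / lambda B] a potential whose flux through the edge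
   above [B] is [kappa^-1 * m B * b B = \int_B kappa^-1 L f]. On small balls
   [phi = f - L f / lambda], and the rate limit makes [lambda] diverge uniformly
   on compact sets, whence the trace and the normal derivative.

   Conversely, if a canonical solution [psi] has flux density [g], put
   [b B := kappa * average of g] and [a B := psi B + b B / lambda B]. Then
   [a B - a B' = (b B - b B') / lambda B'], so [a] inherits the mean value
   property of [b]; on small balls [a] is locally constant and equal to the trace
   [f], hence [a] is the family of averages of [f] everywhere, [b] is the family
   of averages of [L f], and [g = kappa^-1 L f].

   The energy of the edges at a given height inside a ball supporting [f] is a
   difference of two consecutive integrals of [g * phi], so the energy
   telescopes. *)

Require Import Defs.
From HB Require Import structures.
From mathcomp Require Import all_boot all_order all_algebra.
From mathcomp Require Import all_classical all_reals all_analysis.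
From mathcomp Require Import measurable_realfun ring lra zify.

Set Implicit Arguments.
Unset Strict Implicit.
Unset Printing Implicit Defensive.

Import Order.TTheory GRing.Theory Num.Theory.
Import numFieldNormedType.Exports.

Local Open Scope classical_set_scope.
Local Open Scope ring_scope.

(** * Combinatorics of the ball hierarchy *)

Section BallTree.
Context {R : realType} {X : pmetricType R}.
Variables (m : {measure set (borel X) -> \bar R}).
Variables (BB : set (set X)) (h : set X -> int).
Hypothesis hBB : ball_hierarchy BB h m.
Implicit Types (A B D : set X) (x y : X) (k : int).

Local Notation "B ^" := (superball BB B) (at level 2, format "B ^").
Local Notation ballat := (ballat BB h).

Lemma covers_superball B : BB B -> covers BB B B^.
Proof.
move=> BBB; have [D [BD _]] := balls_super hBB BBB.
by apply: (@xgetPex _ set0 [set D | covers BB B D]); exists D.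
Qed.

Lemma superball_mem B : BB B -> BB B^.
Proof. by move=> /covers_superball[]. Qed.

Lemma subset_superball B : BB B -> B `<=` B^.
Proof. by move=> /covers_superball[_ _ []]. Qed.

Lemma covers_superballE A B : covers BB A B -> A^ = B.
Proof.
move=> AB; have [BBA _ _ _] := AB; have [D [_ uD]] := balls_super hBB BBA.
by rewrite -(uD _ AB) (uD _ (covers_superball BBA)).
Qed.

Lemma height_superball B : BB B -> h B^ = h B - 1.
Proof. by move=> /(height_step hBB) <-; rewrite opprB addrCA subrr addr0. Qed.

Lemma height_sub A B : sub BB B A -> h A = h B + 1.
Proof.
by move=> AB; have [BBA _ _ _] := AB; rewrite -(covers_superballE AB)
  height_superball// subrK.
Qed.

Lemma iter_superball_mem n B : BB B -> BB (iter n (superball BB) B).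
Proof. by move=> BBB; elim: n => //= n /superball_mem. Qed.

Lemma subset_iter_superball n B : BB B -> B `<=` iter n (superball BB) B.
Proof.
move=> BBB; elim: n => //= n /subset_trans; apply.
exact/subset_superball/iter_superball_mem.
Qed.

Lemma height_iter_superball n B : BB B ->
  h (iter n (superball BB) B) = h B - n%:Z.
Proof.
move=> BBB; elim: n => [|n IHn]; first by rewrite subr0.
by rewrite /= height_superball ?IHn; [lia|exact: iter_superball_mem].
Qed.

Lemma ballatP k x : [/\ BB (ballat k x), h (ballat k x) = k & ballat k x x].
Proof.
have [B [BP _]] := height_partition hBB k x.
by apply: (@xgetPex _ set0 [set B | [/\ BB B, h B = k & B x]]); exists B.
Qed.

Lemma ballat_mem k x : BB (ballat k x). Proof. by case: (ballatP k x). Qed.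

Lemma height_ballat k x : h (ballat k x) = k. Proof. by case: (ballatP k x). Qed.

Lemma ballat_self k x : ballat k x x. Proof. by case: (ballatP k x). Qed.

Lemma ballatE B x : BB B -> B x -> ballat (h B) x = B.
Proof.
move=> BBB Bx; have [D [_ uD]] := height_partition hBB (h B) x.
by rewrite -(uD _ (ballatP (h B) x)); exact: uD.
Qed.

Lemma eq_height_ball A B x : BB A -> BB B -> h A = h B -> A x -> B x -> A = B.
Proof.
by move=> BBA BBB hAB Ax Bx; rewrite -(ballatE BBA Ax) hAB ballatE.
Qed.

(** Climbing [h A - h B] super-balls from [A] gives a ball of height [h B] through [x]; balls of one
    height partition the space, so this ball is [B]. *)
Lemma ball_nested A B x : BB A -> BB B -> h B <= h A -> A x -> B x -> A `<=` B.
Proof.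
move=> BBA BBB hBA Ax Bx.
have <- : iter `|h A - h B|%N (superball BB) A = B.
  apply: (@eq_height_ball _ _ x) => //.
  - exact: iter_superball_mem.
  - by rewrite height_iter_superball//; lia.
  - exact: subset_iter_superball.
exact: subset_iter_superball.
Qed.

Lemma basis_ball_nonempty B : BB B -> B !=set0.
Proof. by move=> /(balls_are_balls hBB)[]. Qed.

Lemma basis_ball_compact B : BB B -> compact B.
Proof. by move=> /(balls_are_balls hBB)[]. Qed.

Lemma basis_ball_open B : BB B -> open B.
Proof. by move=> /(balls_are_balls hBB)[]. Qed.

Lemma subset_height A B : BB A -> BB B -> A `<=` B -> h B <= h A.
Proof.
move=> BBA BBB AB; have [x Ax] := basis_ball_nonempty BBA.
rewrite leNgt; apply/negP => hAB.
have BA : B `<=` A by apply: (@ball_nested _ _ x) => //; [exact: ltW|exact: AB].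
have eAB : A = B by apply/seteqP.
by rewrite eAB ltxx in hAB.
Qed.

Lemma superball_ballat k x : (ballat k x)^ = ballat (k - 1) x.
Proof.
apply: (@eq_height_ball _ _ x); rewrite ?height_superball ?height_ballat//.
- exact/superball_mem/ballat_mem.
- exact: ballat_mem.
- exact: ballat_mem.
- exact/subset_superball/ballat_self/ballat_mem.
- exact: ballat_self.
Qed.

Lemma ballat_sub B k x : BB B -> B x -> h B <= k -> ballat k x `<=` B.
Proof.
move=> BBB Bx hB; apply: (@ball_nested _ _ x) => //; last exact: ballat_self.
- exact: ballat_mem.
- by rewrite height_ballat.
Qed.

Lemma ballat_eq k x y : ballat k x y -> ballat k y = ballat k x.
Proof.
by move=> kxy; rewrite -[RHS](ballatE (ballat_mem k x) kxy) height_ballat.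
Qed.

(** Passing to sub-balls raises the height by one, so finitely many descents reach height [N]. This
    carries identities from fine balls to all balls. *)
Lemma ball_height_ind (P : set X -> Prop) N :
  (forall B, BB B -> N <= h B -> P B) ->
  (forall B, BB B -> (forall A, sub BB B A -> P A) -> P B) ->
  forall B, BB B -> P B.
Proof.
move=> Pfine Psub.
have {}Pfine n B : BB B -> N - n%:Z <= h B -> P B.
  elim: n B => [|n IHn] B BBB hB.
    by apply: Pfine => //; rewrite subr0 in hB.
  apply: Psub => // A AB; have [BBA _ _ _] := AB.
  by apply: IHn => //; rewrite (height_sub AB); lia.
by move=> B BBB; apply: (Pfine `|N - h B|%N) => //; lia.
Qed.

(** Every ball has an iterated super-ball containing [D], so a property can be propagated downwards
    from the large balls, where the averages of a mean-zero function supported in [D] vanish. *)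
Lemma ball_super_ind (P : set X -> Prop) D : BB D ->
  (forall B, BB B -> D `<=` B -> P B) ->
  (forall B, BB B -> P B^ -> P B) -> forall B, BB B -> P B.
Proof.
move=> BBD Plarge Psuper B BBB.
have [E [BBE BE DE [n En] _]] := balls_common hBB BBB BBD.
have : P (iter n (superball BB) B) by rewrite -En; exact: Plarge.
elim: n {En} => // n IHn /= /Psuper Pn; apply: IHn; apply: Pn.
exact: iter_superball_mem.
Qed.

Definition cone B : set (set X) := [set D | BB D /\ B `<=` D].

(** A ball containing [B] has height at most [h B]. With equality it is [B]; otherwise its height is
    at most that of [B^], which it meets and hence contains. Each Abel summation peels off one term
    this way. *)
Lemma cone_superball B : BB B -> cone B = B |` cone B^.
Proof.
move=> BBB; have [x Bx] := basis_ball_nonempty BBB.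
apply/seteqP; split => [D [BBD BD]|D [->|[BBD BD]]].
- have := subset_height BBB BBD BD; rewrite le_eqVlt => /orP[/eqP hDB|hDB].
    by left; apply: (@eq_height_ball _ _ x) => //; exact: BD.
  right; split=> //; apply: (@ball_nested _ _ x) => //.
  + exact: superball_mem.
  + by rewrite height_superball//; lia.
  + exact: subset_superball.
  + exact: BD.
- by split.
- by split=> //; exact: subset_trans (subset_superball BBB) BD.
Qed.

Lemma cone_notin B : BB B -> ~ cone B^ B.
Proof.
move=> BBB [_ BB'].
have := subset_height (superball_mem BBB) BBB BB'.
by rewrite height_superball//; lia.
Qed.

(** The iterated super-balls of one fixed ball are open, increasing and cover the space; compactness
    selects one of them. *)
Lemma bounded_in_ball (K : set X) : compact K -> exists2 D, BB D & K `<=` D.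
Proof.
move=> /compact_near_coveringP cK.
pose B0 := ballat 0 point; have BB0 : BB B0 := ballat_mem _ _.
have /cK : forall x, K x -> \forall y \near x & n \near \oo,
    iter n (superball BB) B0 y.
  move=> x _; have : (\bigcup_n iter n (superball BB) B0) x.
    by rewrite (balls_exhaust hBB BB0).
  move=> [n _ nx]; exists (iter n (superball BB) B0, [set p | (n <= p)%N]).
    split=> /=; last by exists n.
    apply: open_nbhs_nbhs; split => //.
    exact/basis_ball_open/iter_superball_mem.
  move=> [y p] /= [ny np]; rewrite -(subnK np) iterD.
  by apply: subset_iter_superball => //; exact: iter_superball_mem.
move=> [n _ /(_ n (leqnn n)) Kn].
by exists (iter n (superball BB) B0); [exact: iter_superball_mem|exact: Kn].
Qed.

Lemma basis_ball_nbhs B x : BB B -> B x -> nbhs x B.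
Proof.
by move=> BBB Bx; apply: open_nbhs_nbhs; split => //; exact: basis_ball_open.
Qed.

Lemma locally_constant_ball (f : X -> R) x : locally_constant f ->
  exists B, [/\ BB B, B x & forall y, B y -> f y = f x].
Proof.
move=> /(_ x) fx; have [_ /(_ x _ fx)] := balls_basis hBB.
by move=> [B [BBB Bx] Bf]; exists B; split => // y /Bf.
Qed.

Lemma locally_constant_ballat k (u : set X -> R) :
  locally_constant (fun x => u (ballat k x)).
Proof.
move=> x.
apply: filterS (basis_ball_nbhs (ballat_mem k x) (ballat_self k x)) => y.
by move=> /ballat_eq ->.
Qed.

Definition fine_constant (N : int) (f : X -> R) :=
  forall B, BB B -> N <= h B -> forall x y, B x -> B y -> f x = f y.

Lemma fine_constant_locally_constant N f :
  fine_constant N f -> locally_constant f.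
Proof.
move=> fN x.
apply: filterS (basis_ball_nbhs (ballat_mem N x) (ballat_self N x)) => y.
move=> Ny; apply: (fN _ (ballat_mem N x)) => //; rewrite ?height_ballat//.
exact: ballat_self.
Qed.

Lemma SX_fine_constant f : SX f ->
  exists D N, [/\ BB D, forall x, ~ D x -> f x = 0 & fine_constant N f].
Proof.
move=> [fl fc]; have [D BBD fD] := bounded_in_ball fc.
have {fD fc} f0 x : ~ D x -> f x = 0.
  move=> nDx; apply/eqP/negP => /negP fx; apply: nDx.
  by apply: fD; exact: subset_closure.
have := (compact_near_coveringP D).1 (basis_ball_compact BBD) nat \oo
  (fun n y => forall z, ballat n%:Z y z -> f z = f y) _.
case.
  move=> x Dx; have [B [BBB Bx Bf]] := locally_constant_ball x fl.
  exists (B, [set n | h B <= n%:Z]).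
    split; first exact: basis_ball_nbhs.
    by exists `|h B|%N => // n /= hBn; lia.
  move=> [y n] /= [By Bn] z yz.
  rewrite !Bf//; apply: (ballat_sub BBB By Bn) yz.
(* With [N] at least [h D], a ball of height at least [N] lies inside [D] or misses it, and in the
   second case [f] vanishes on it. *)
move=> n _ Dn; pose N := Num.max n%:Z (h D).
exists D, N; split => //.
move=> B BBB; rewrite ge_max => /andP[nB DB] x y Bx By.
have [Dx|nDx] := pselect (D x).
  have BD := ball_nested BBB BBD DB Bx Dx.
  have := Dn `|h B|%N; rewrite /= => /(_ _ x Dx y); rewrite gez0_abs; last lia.
  by rewrite ballatE// => -> //; lia.
rewrite !f0// => Dy; apply: nDx.
exact: (ball_nested BBB BBD DB By Dy).
Qed.

End BallTree.

(** * Absolutely summable families of real numbers *)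

Section SetSum.
Context {R : realType} {I : choiceType}.
Implicit Types (S T : set I) (a b : I -> R) (u v c : R).

(** [setsum] passes through [fine], which hides infinite values; recording that both parts are
    finite is what makes the algebra of such sums legitimate. *)
Definition has_setsum S a v := exists p q : R,
  [/\ (\esum_(i in S) (a^\+ i)%:E)%E = p%:E,
      (\esum_(i in S) (a^\- i)%:E)%E = q%:E & v = p - q].

Lemma has_setsumE S a v : has_setsum S a v -> setsum S a = v.
Proof. by move=> [p [q [pE qE ->]]]; rewrite /setsum pE qE. Qed.

Lemma le_esumZl S a c : 0 <= c -> (forall i, S i -> 0 <= a i) ->
  (\esum_(i in S) (c * a i)%:E <= c%:E * \esum_(i in S) (a i)%:E)%E.
Proof.
move=> c0 a0; rewrite ge_ereal_sup => //= _ [F [finF FS]] <-.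
have -> : (\sum_(i \in F) (c * a i)%:E = c%:E * \sum_(i \in F) (a i)%:E)%E.
  by rewrite !fsumEFin// -EFinM mulr_fsumr.
by rewrite lee_wpmul2l// ?lee_fin//; apply: ereal_sup_ubound; exists F.
Qed.

(** The converse inequality is [le_esumZl] for the factor [c^-1] and the scaled family, hence the
    separate case [c = 0]. *)
Lemma esumZl S a c : 0 <= c -> (forall i, S i -> 0 <= a i) ->
  (\esum_(i in S) (c * a i)%:E = c%:E * \esum_(i in S) (a i)%:E)%E.
Proof.
move=> c0 a0; apply/eqP; rewrite eq_le le_esumZl//=.
have [->|c_neq0] := eqVneq c 0.
  by rewrite mul0e esum_ge0// => i _; rewrite mul0r.
have {}c0 : 0 < c by rewrite lt_neqAle eq_sym c_neq0.
rewrite -lee_pdivlMl//.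
have := @le_esumZl S (fun i => c * a i) c^-1.
rewrite invr_ge0 (ltW c0) => /(_ isT).
under eq_esum do rewrite mulKf ?gt_eqF//.
by apply=> i Si; rewrite mulr_ge0 ?a0// ltW.
Qed.

Lemma has_setsumZr S a s c : (forall i, S i -> 0 <= a i) ->
  (\esum_(i in S) (a i)%:E)%E = s%:E -> has_setsum S (fun i => a i * c) (s * c).
Proof.
(* As [a] is nonnegative, the positive and negative parts of the family are [a] scaled by the
   positive and negative parts of [c]. *)
move=> a0 aE; exists (Num.max c 0 * s), (Num.max (- c) 0 * s); split.
- rewrite EFinM -aE -esumZl ?le_max ?lexx ?orbT//.
  apply: eq_esum => i Si.
  by rewrite /funrpos mulrC -[0 in LHS](mul0r (a i)) maxr_pMl// a0.
- rewrite EFinM -aE -esumZl ?le_max ?lexx ?orbT//.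
  apply: eq_esum => i Si.
  by rewrite /funrneg mulrC -mulNr -[0 in LHS](mul0r (a i)) maxr_pMl// a0.
- rewrite -mulrBl mulrC; congr (_ * _).
  by rewrite !maxEle; case: ifP; case: ifP; lra.
Qed.

Lemma esum_setU1 S i a : ~ S i -> (forall j, 0 <= a j) ->
  (\esum_(j in i |` S) (a j)%:E = (a i)%:E + \esum_(j in S) (a j)%:E)%E.
Proof.
move=> nSi a0; rewrite (esumID [set i])//; last by move=> j _; rewrite lee_fin.
congr (_ + _)%E.
  rewrite (_ : _ `&` _ = [set i]) ?esum_set1 ?lee_fin//.
  by apply/seteqP; split => [j [_ ->]|j ->] //; split => //; left.
congr esum; apply/seteqP; split => [j [[->|//] /(_ erefl)]|j Sj] //.
by split; [right|move=> /= ji; apply: nSi; rewrite -ji].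
Qed.

Lemma has_setsumU1 S i a v : ~ S i ->
  has_setsum S a v -> has_setsum (i |` S) a (a i + v).
Proof.
move=> nSi [p [q [pE qE ->]]]; exists (a^\+ i + p), (a^\- i + q).
rewrite !esum_setU1 ?pE ?qE//; split => //.
suff : a^\+ i - a^\- i = a i by lra.
by rewrite /funrpos /funrneg !maxEle; case: ifP; case: ifP; lra.
Qed.

Lemma setsum_subset S T a : T `<=` S -> (forall i, S i -> ~ T i -> a i = 0) ->
  setsum S a = setsum T a.
Proof.
move=> TS a0; rewrite /setsum; congr (fine (_ - _)%E); rewrite esum_mkcond;
  rewrite [RHS]esum_mkcond; apply: eq_esum => i _;
  case: (pselect (T i)) => Ti; rewrite ?(mem_set Ti) ?(mem_set (TS _ Ti))//;
  rewrite (memNset Ti); case: ifPn => //; rewrite inE => Si;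
  by rewrite /funrpos /funrneg a0// ?oppr0 maxxx.
Qed.

Lemma eq_setsum S a b : (forall i, S i -> a i = b i) -> setsum S a = setsum S b.
Proof.
by move=> ab; rewrite /setsum; congr (fine (_ - _)%E); apply: eq_esum => i Si;
  rewrite /funrpos /funrneg ab.
Qed.

Lemma setsum_eq0 S a : (forall i, S i -> a i = 0) -> setsum S a = 0.
Proof.
move=> a0; rewrite /setsum !esum1 ?sube0// => i Si;
  by rewrite /funrpos /funrneg a0// ?oppr0 maxxx.
Qed.

End SetSum.

(** * Rates and the Laplacian as a function of balls *)

Section Laplacian.
Context {R : realType} {X : pmetricType R}.
Variables (m : {measure set (borel X) -> \bar R}).
Variables (BB : set (set X)) (h : set X -> int).
Hypothesis hBB : ball_hierarchy BB h m.
Variable C : set X -> R.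
Hypothesis hC : hierarchical_rates BB h C.
Implicit Types (A B D : set X) (x y : X) (k : int) (a : set X -> R).

Local Notation "B ^" := (superball BB B) (at level 2, format "B ^").
Local Notation lambda := (lambda BB C).

Lemma rate_gt0 B : BB B -> 0 < C B.
Proof. by case: hC => + _ _; exact. Qed.

Lemma elambdaE B : BB B -> elambda BB C B = (lambda B)%:E.
Proof.
move=> BBB; rewrite /Defs.lambda fineK// ge0_fin_numE.
  by case: hC => _ + _; exact.
by apply: esum_ge0 => D [BBD _]; rewrite lee_fin ltW// rate_gt0.
Qed.

Lemma has_setsum_coneZ B c : BB B ->
  has_setsum (cone BB B) (fun D => C D * c) (lambda B * c).
Proof.
move=> BBB; apply: has_setsumZr.
  by move=> D [BBD _]; rewrite ltW// rate_gt0.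
exact: elambdaE.
Qed.

Lemma has_setsum_cone_superball B (t : set X -> R) (v : R) : BB B ->
  has_setsum (cone BB B^) t v -> has_setsum (cone BB B) t (t B + v).
Proof.
move=> BBB Bv; rewrite (cone_superball hBB BBB); apply: has_setsumU1 => //.
exact: (cone_notin hBB).
Qed.

Lemma lambda_superball B : BB B -> lambda B = C B + lambda B^.
Proof.
move=> BBB; have BB' := superball_mem hBB BBB.
have := has_setsum_cone_superball BBB (has_setsum_coneZ 1 BB').
by move=> /has_setsumE; rewrite (has_setsumE (has_setsum_coneZ 1 BBB)) !mulr1.
Qed.

Lemma lambda_gt0 B : BB B -> 0 < lambda B.
Proof.
move=> BBB; rewrite lambda_superball// ltr_pwDl ?rate_gt0//.
rewrite -lee_fin -elambdaE; last exact: (superball_mem hBB).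
by apply: esum_ge0 => D [BBD _]; rewrite lee_fin ltW// rate_gt0.
Qed.

Lemma lambda_subset A B : BB A -> BB B -> A `<=` B -> lambda B <= lambda A.
Proof.
move=> BBA BBB AB; rewrite -lee_fin -!elambdaE//.
rewrite /elambda esum_mkcond [leRHS]esum_mkcond; apply: le_esum => D _.
case: ifPn => [|_]; rewrite ?inE.
  by move=> [BBD BD]; rewrite ifT// inE; split => //; exact: subset_trans BD.
by case: ifPn => //; rewrite inE => -[BBD _]; rewrite lee_fin ltW// rate_gt0.
Qed.

(* When [a] is the family of averages of [f], this is the average over [B] of
   the Laplacian of [f]. *)
Definition ball_laplacian a B : R :=
  setsum (cone BB B) (fun D => C D * (a B - a D)).

(** The sum is affine in [c] with slope [lambda B]. Quantifying over [c] lets the induction recentre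
    it from [a B^] to [a B], the remainder [b] being independent of [c]. Above [D] the family
    vanishes and only [lambda B * c] is left. *)
Lemma has_setsum_ball_laplacian a D : BB D ->
  (forall E, BB E -> D `<=` E -> a E = 0) ->
  forall B, BB B -> forall c, has_setsum (cone BB B) (fun E => C E * (c - a E))
    (lambda B * (c - a B) + ball_laplacian a B).
Proof.
move=> BBD a0 B BBB.
suff [b Hb] : exists b, forall c, has_setsum (cone BB B)
    (fun E => C E * (c - a E)) (lambda B * (c - a B) + b).
  by rewrite /ball_laplacian (has_setsumE (Hb _)) subrr mulr0 add0r.
move: B BBB; apply: (ball_super_ind hBB BBD) => [B BBB DB|B BBB [b Hb]].
  exists 0 => c; rewrite a0// addr0.
  rewrite subr0.
  have [p [q [pE qE pq]]] := has_setsum_coneZ c BBB.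
  exists p, q; split => //.
    rewrite -pE; apply: eq_esum => E [BBE BE].
    by rewrite /funrpos a0 ?subr0//; exact: subset_trans BE.
  rewrite -qE; apply: eq_esum => E [BBE BE].
  by rewrite /funrneg a0 ?subr0//; exact: subset_trans BE.
exists (lambda B^ * (a B - a B^) + b) => c.
have := has_setsum_cone_superball BBB (Hb c); congr has_setsum.
by rewrite [in RHS]lambda_superball//; ring.
Qed.

(** Choosing [c = a B] in the affine formula over the cone of [B^] makes the additional term, that
    of [B] itself, vanish. *)
Lemma ball_laplacian_superball a D : BB D ->
  (forall E, BB E -> D `<=` E -> a E = 0) -> forall B, BB B ->
  ball_laplacian a B - ball_laplacian a B^ = lambda B^ * (a B - a B^).
Proof.
move=> BBD a0 B BBB; have BB' := superball_mem hBB BBB.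
have Hb := has_setsum_ball_laplacian BBD a0.
have := has_setsum_cone_superball BBB (Hb _ BB' (a B)) => /has_setsumE.
by rewrite (has_setsumE (Hb _ BBB _)) !subrr !mulr0 !add0r => ->; rewrite addrK.
Qed.

Lemma ball_laplacian_eq0 a B :
  (forall E, BB E -> B `<=` E -> a E = 0) -> BB B -> ball_laplacian a B = 0.
Proof.
move=> a0 BBB; apply: setsum_eq0 => E [BBE BE].
by rewrite !a0// subrr mulr0.
Qed.

(** Balls around [x] at least as fine as [B] contribute nothing, their averages being [f x]; all
    coarser ones contain [B], so only the cone of [B] matters. *)
Lemma hierarchical_laplacianE f B x : BB B -> B x ->
  (forall E, BB E -> E x -> h B <= h E -> average m f E = f x) ->
  hierarchical_laplacian BB C m f x = ball_laplacian (average m f) B.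
Proof.
move=> BBB Bx fB; rewrite /hierarchical_laplacian /ball_laplacian.
rewrite (@setsum_subset _ _ _ (cone BB B)).
- by apply: eq_setsum => E _; rewrite (fB B).
- by move=> E [BBE BE]; split => //; exact: BE.
- move=> E [BBE Ex] nBE; rewrite fB ?subrr ?mulr0//.
  rewrite leNgt; apply/negP => hEB; apply: nBE; split => //.
  by apply: (ball_nested hBB BBB BBE _ Bx Ex); exact: ltW.
Qed.

End Laplacian.

(** * Integrals of locally constant functions over balls *)

Section Integration.
Context {R : realType} {X : pmetricType R}.
Variables (m : {measure set (borel X) -> \bar R}).
Variables (BB : set (set X)) (h : set X -> int).
Hypothesis hBB : ball_hierarchy BB h m.
Implicit Types (A B D : set X) (x y : X) (k : int) (w : X -> R).

Local Notation mass B := (fine (m B)).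

Lemma basis_ball_measurable B : BB B -> measurable (B : set (borel X)).
Proof.
by move=> BBB; apply: sub_sigma_algebra; exact: (basis_ball_open hBB).
Qed.

Lemma massE B : BB B -> m B = (mass B)%:E.
Proof.
move=> /(balls_measure hBB)/andP[B0 Boo].
by rewrite fineK// ge0_fin_numE// ltW.
Qed.

Lemma mass_gt0 B : BB B -> 0 < mass B.
Proof.
by move=> BBB; have /andP[+ _] := balls_measure hBB BBB; rewrite massE.
Qed.

(** The preimage of any set under a locally constant function is open. *)
Lemma locally_constant_measurable w (D : set (borel X)) : locally_constant w ->
  measurable_fun D (w : borel X -> R).
Proof.
move=> wl; apply: (@measurable_funS _ _ _ _ setT) => //.
move=> _ U _; rewrite setTI; apply: sub_sigma_algebra.
suff : open (w @^-1` U) by [].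
rewrite openE => x Ux; apply: filterS (wl x) => y wy.
by rewrite /preimage/= wy.
Qed.

Lemma locally_constant_comp2 (F : R -> R -> R) (w1 w2 : X -> R) :
  locally_constant w1 -> locally_constant w2 ->
  locally_constant (fun x => F (w1 x) (w2 x)).
Proof.
move=> wl1 wl2 x.
by apply: filterS (filterI (wl1 x) (wl2 x)) => y [/= -> ->].
Qed.

Lemma locally_constant_comp (F : R -> R) w :
  locally_constant w -> locally_constant (fun x => F (w x)).
Proof. by move=> wl x; apply: filterS (wl x) => y ->. Qed.

Lemma locally_constant_bounded w D : BB D -> locally_constant w ->
  exists M : R, forall x, D x -> `|w x| <= M.
Proof.
move=> BBD wl.
have := (compact_near_coveringP D).1 (basis_ball_compact hBB BBD) nat \oo
  (fun n y => `|w y| <= n%:R) _.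
case.
  move=> x Dx; exists ([set y | w y = w x], [set n | `|w x| <= n%:R]).
    split; first exact: wl.
    exact: nbhs_infty_ger.
  by move=> [y n] /= [-> ].
by move=> n _ /(_ n (leqnn n)) Dn; exists n%:R => x /Dn.
Qed.

Lemma locally_constant_integrable w D : BB D -> locally_constant w ->
  m.-integrable (D : set (borel X)) (EFin \o w).
Proof.
move=> BBD wl; apply: measurable_bounded_integrable.
- exact: basis_ball_measurable.
- by have /andP[] := balls_measure hBB BBD.
- exact: locally_constant_measurable.
- have [M wM] := locally_constant_bounded BBD wl.
  exists M; split; first exact: num_real.
  by move=> N MN x /wM /le_trans; apply; exact: ltW.
Qed.

Lemma Rintegral_ball_cst w c B : BB B -> (forall x, B x -> w x = c) ->
  \int[m]_(x in B) w x = c * mass B.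
Proof.
move=> BBB wc; rewrite -Rintegral_cst; last exact: basis_ball_measurable.
by apply: eq_Rintegral => x /set_mem/wc.
Qed.

Lemma Rintegral_support w D : (forall x, ~ D x -> w x = 0) ->
  \int[m]_x w x = \int[m]_(x in D) w x.
Proof.
move=> w0; rewrite [RHS]Rintegral_mkcond; apply: eq_Rintegral => x _.
by rewrite patchE; case: ifPn => //; rewrite notin_setE => /w0.
Qed.

Lemma Rintegral_eq0 w D : (forall x, D x -> w x = 0) ->
  \int[m]_(x in D) w x = 0.
Proof.
move=> w0; rewrite (@eq_Rintegral _ _ _ _ _ (cst 0)).
  by rewrite /Rintegral integral0.
by move=> x /set_mem/w0.
Qed.

Lemma Rintegral_ball_le w D e : BB D -> locally_constant w ->
  (forall x, D x -> `|w x| <= e) -> `|\int[m]_(x in D) w x| <= e * mass D.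
Proof.
move=> BBD wl we; have mD := basis_ball_measurable BBD.
rewrite -(Rintegral_cst _ mD).
apply: le_trans (le_normr_Rintegral mD (locally_constant_integrable BBD wl)) _.
apply: le_Rintegral => //; apply: locally_constant_integrable => //.
- exact: (locally_constant_comp Num.norm).
- by move=> x; exact: nearW.
Qed.

Lemma Rintegral_partition w D (T : set (set X)) : BB D -> locally_constant w ->
  finite_set T -> T `<=` BB -> trivIset T id -> \bigcup_(A in T) A = D ->
  \sum_(A \in T) \int[m]_(x in A) w x = \int[m]_(x in D) w x.
Proof.
move=> BBD wl finT TBB trivT TD.
(* [F] sends non-balls to the empty set, so that measurability holds at every index and not only on
   [T]. *)
pose F A : set (borel X) := if `[< BB A >] then A else set0.
have FE A : BB A -> F A = A by move=> BBA; rewrite /F asboolT.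
have DE : D = \big[setU/set0]_(A <- finmap.enum_fset (fset_set T)) F A.
  rewrite -TD bigsetU_fset_set//; apply/seteqP; split => x [A TA];
    rewrite ?FE//; try exact: TBB; by exists A => //; rewrite FE//; exact: TBB.
rewrite /Rintegral [in RHS]DE integral_bigsetU_EFin//; first last.
- apply/measurable_EFinP. exact: locally_constant_measurable.
- rewrite fset_setK//; move: trivT; rewrite /trivIset/= => trivT A B TA TB.
  by rewrite !FE; [exact: trivT|exact: TBB|exact: TBB].
- by move=> A; rewrite /F; case: asboolP => // /basis_ball_measurable.
rewrite fsbig_finite//= -[RHS]sum_fine.
  rewrite big_seq [RHS]big_seq; apply: eq_bigr => A.
  by rewrite in_fset_set// => /set_mem/TBB/FE ->.
move=> A _; apply: integrable_fin_num.
  by rewrite /F; case: asboolP => // /basis_ball_measurable.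
rewrite /F; case: asboolP => [BBA|_]; first exact: locally_constant_integrable.
exact: integrable_set0.
Qed.

End Integration.

(** * Convergence in L2 of locally constant functions *)

Section L2Convergence.
Context {R : realType} {X : pmetricType R}.
Variables (m : {measure set (borel X) -> \bar R}).
Variables (BB : set (set X)) (h : set X -> int).
Hypothesis hBB : ball_hierarchy BB h m.
Implicit Types (A B D : set X) (x y : X) (k : int) (w : X -> R).

Local Notation mass B := (fine (m B)).

Lemma measurable_abse_sqr (w : borel X -> R) (D : set (borel X)) :
  measurable_fun D w ->
  measurable_fun D (fun x => `|(EFin \o w) x| `^ 2)%E.
Proof.
move=> mw; apply: (measurableT_comp (measurable_poweR _)).
apply: measurableT_comp => //.
exact/measurable_EFinP.
Qed.

Lemma abse_sqrE w x : (`|(EFin \o w) x| `^ 2 = (`|w x| ^+ 2)%:E)%E.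
Proof. by rewrite poweR_EFin powR_mulrn. Qed.

Lemma Lnorm2_ball_le w D e : BB D -> locally_constant w ->
  (forall x, ~ D x -> w x = 0) -> 0 <= e -> (forall x, D x -> `|w x| <= e) ->
  ('N[m]_2%:E[EFin \o w] <= (e * Num.sqrt (mass D))%:E)%E.
Proof.
have sq0 x : (0 <= `|(EFin \o w) x| `^ 2)%E by exact: poweR_ge0.
move=> BBD wl w0 e0 we; rewrite unlock poweR12_sqrt ?integral_ge0//.
have -> : (e * Num.sqrt (mass D))%:E = sqrte (e ^+ 2 * mass D)%:E.
  by rewrite /= sqrtrM ?sqr_ge0// sqrtr_sqr ger0_norm.
rewrite lee_sqrt ?lee_fin ?mulr_ge0 ?sqr_ge0 ?(ltW (mass_gt0 hBB BBD))//.
have -> : (\int[m]_x (`|(EFin \o w) x| `^ 2))%E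
    = (\int[m]_(x in D) (`|(EFin \o w) x| `^ 2))%E.
  rewrite [RHS]integral_mkcond; apply: eq_integral => x _.
  rewrite patchE; case: ifPn => //; rewrite notin_setE => /w0 wx0.
  by rewrite abse_sqrE wx0 normr0 expr0n.
rewrite EFinM -(massE hBB BBD) -integral_cst; last first.
  exact: (basis_ball_measurable hBB).
apply: ge0_le_integral => //.
- exact: (basis_ball_measurable hBB).
- by apply: measurable_abse_sqr; exact: locally_constant_measurable.
- by move=> x Dx; rewrite abse_sqrE lee_fin ler_sqr ?nnegrE// we.
Qed.

(** A Chebyshev estimate: restricting the integral of the square to [B] can only decrease it. *)
Lemma Lnorm2_ball_ge (w : borel X -> R) B c : BB B -> measurable_fun setT w ->
  0 <= c -> (forall x, B x -> c <= `|w x|) ->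
  ((c * Num.sqrt (mass B))%:E <= 'N[m]_2%:E[EFin \o w])%E.
Proof.
have sq0 x : (0 <= `|(EFin \o w) x| `^ 2)%E by exact: poweR_ge0.
move=> BBB mw c0 cw; rewrite unlock poweR12_sqrt ?integral_ge0//.
have -> : (c * Num.sqrt (mass B))%:E = sqrte (c ^+ 2 * mass B)%:E.
  by rewrite /= sqrtrM ?sqr_ge0// sqrtr_sqr ger0_norm.
have mB := basis_ball_measurable hBB BBB.
rewrite lee_sqrt ?integral_ge0//.
apply: (@le_trans _ _ (\int[m]_(x in B) (`|(EFin \o w) x| `^ 2))%E); last first.
  by apply: ge0_subset_integral => //; exact: measurable_abse_sqr.
rewrite EFinM -(massE hBB BBB) -integral_cst//.
apply: ge0_le_integral => //.
- by move=> x _; rewrite lee_fin sqr_ge0.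
- by apply: measurable_abse_sqr; exact: measurable_funTS.
- by move=> x Bx; rewrite abse_sqrE lee_fin ler_sqr ?nnegrE// cw.
Qed.

Lemma L2_locally_constant w D : BB D -> locally_constant w ->
  (forall x, ~ D x -> w x = 0) -> L2 m w.
Proof.
move=> BBD wl w0; rewrite /L2; apply/andP; split; apply/mem_set => /=.
  exact: locally_constant_measurable.
have [M wM] := locally_constant_bounded hBB BBD wl.
apply: le_lt_trans (ltry (Num.max M 0 * Num.sqrt (mass D))).
apply: Lnorm2_ball_le => //; first by rewrite le_max lexx orbT.
by move=> x /wM; rewrite le_max => ->.
Qed.

(** With all supports eventually in [D], a uniform error [e] costs at most [e * Num.sqrt (mass D)]
    in norm. *)
Lemma cvgL2_uniform (u : nat -> X -> R) w D : BB D ->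
  (\forall n \near \oo,
    locally_constant (u n) /\ forall x, ~ D x -> u n x = 0) ->
  locally_constant w -> (forall x, ~ D x -> w x = 0) ->
  (forall e, 0 < e ->
    \forall n \near \oo, forall x, D x -> `|u n x - w x| <= e) ->
  cvgL2 m u w.
Proof.
move=> BBD ul wl w0 uw; split.
- by apply: filterS ul => n [unl un0]; exact: L2_locally_constant un0.
- exact: L2_locally_constant w0.
have s0 : 0 < Num.sqrt (mass D) by rewrite sqrtr_gt0 (mass_gt0 hBB BBD).
have uwn e : 0 < e -> \forall n \near \oo,
    ('N[m]_2%:E[EFin \o (u n \- w)%R] <= e%:E)%E.
  move=> e0; near=> n.
  have [unl un0] : locally_constant (u n) /\ forall x, ~ D x -> u n x = 0.
    by near: n.
  rewrite -[e](@divfK _ (Num.sqrt (mass D))) ?gt_eqF//.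
  apply: Lnorm2_ball_le => //.
  - exact: (locally_constant_comp2 (fun a b => a - b)).
  - by move=> x nDx; rewrite /= un0// w0// subrr.
  - by rewrite divr_ge0// ltW.
  - by near: n; apply: uw; rewrite divr_gt0.
have N0 n : (0 <= 'N[m]_2%:E[EFin \o (u n \- w)%R])%E by exact: Lnorm_ge0.
apply/fine_cvgP; split.
  apply: filterS (uwn 1 ltr01) => n un1.
  by rewrite ge0_fin_numE// (le_lt_trans un1) ?ltry.
apply/cvgr0Pnorm_le => e e0; apply: filterS (uwn e e0) => n une.
rewrite /= ger0_norm ?fine_ge0// -lee_fin fineK//.
by rewrite ge0_fin_numE// (le_lt_trans une) ?ltry.
Unshelve. all: by end_near. Qed.

(** If [u n] stayed at distance at least [c] from [w] on all of [B], the norm would be at least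
    [c * Num.sqrt (mass B)]. This extracts pointwise information from an L2 trace. *)
Lemma cvgL2_ball_ex (u : nat -> X -> R) w B c : BB B -> 0 < c ->
  cvgL2 m u w ->
  \forall n \near \oo, exists2 x, B x & `|u n x - w x| < c.
Proof.
move=> BBB c0 [ul wl uw].
have s0 : 0 < Num.sqrt (mass B) by rewrite sqrtr_gt0 (mass_gt0 hBB BBB).
have cs0 : (0 < (c * Num.sqrt (mass B))%:E)%E by rewrite lte_fin mulr_gt0.
have : \forall n \near \oo,
    ('N[m]_2%:E[EFin \o (u n \- w)%R] < (c * Num.sqrt (mass B))%:E)%E.
  apply: (uw [set y | (y < (c * Num.sqrt (mass B))%:E)%E]).
  exact: (@nbhs_open_ereal_lt R 0 (fun=> c * Num.sqrt (mass B)) cs0).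
apply: filterS2 ul => n unl; apply: contraPP => nex.
apply/negP; rewrite -leNgt; apply: Lnorm2_ball_ge => //; last first.
- move=> x Bx; rewrite leNgt; apply/negP => uwx; apply: nex.
  by exists x.
- exact: ltW.
- by apply: measurable_funB;
    [exact: (set_mem (sub_Lfun_mfun unl))|exact: (set_mem (sub_Lfun_mfun wl))].
Qed.

End L2Convergence.

(** * Averages and the mean value property *)

Section MeanValue.
Context {R : realType} {X : pmetricType R}.
Variables (m : {measure set (borel X) -> \bar R}).
Variables (BB : set (set X)) (h : set X -> int).
Hypothesis hBB : ball_hierarchy BB h m.
Implicit Types (A B D : set X) (x y : X) (w : X -> R) (u v : set X -> R).

Local Notation "B ^" := (superball BB B) (at level 2, format "B ^").
Local Notation mass B := (fine (m B)).

Lemma mass_averageE w B : BB B -> mass B * average m w B = \int[m]_(y in B) w y.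
Proof. by move=> BBB; rewrite /average mulVKf// gt_eqF// (mass_gt0 hBB). Qed.

Lemma average_cst w c B : BB B -> (forall x, B x -> w x = c) ->
  average m w B = c.
Proof.
move=> BBB wc; apply: (mulfI (lt0r_neq0 (mass_gt0 hBB BBB))).
by rewrite mass_averageE// (Rintegral_ball_cst hBB BBB wc) mulrC.
Qed.

Lemma Rintegral_sub w B : BB B -> locally_constant w ->
  \sum_(A \in sub BB B) \int[m]_(x in A) w x = \int[m]_(x in B) w x.
Proof.
move=> BBB wl; have [finB _ trivB coverB] := balls_sub hBB BBB.
by apply: (Rintegral_partition hBB) => // A [].
Qed.

(** The martingale property of a vertex function with respect to the successive partitions into
    balls. *)
Definition mean_value u := forall B, BB B ->
  \sum_(A \in sub BB B) mass A * u A = mass B * u B.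

Lemma mean_value_average w : locally_constant w -> mean_value (average m w).
Proof.
move=> wl B BBB; rewrite mass_averageE// -Rintegral_sub//.
by apply: eq_fsbigr => A /set_mem[BBA _ _ _]; rewrite mass_averageE.
Qed.

Lemma mass_sub B : BB B -> \sum_(A \in sub BB B) mass A = mass B.
Proof.
move=> BBB.
have lc1 : locally_constant (cst (1 : R) : X -> R) by move=> x; exact: nearW.
have := mean_value_average lc1 BBB.
rewrite (@average_cst _ 1)// mulr1 => <-.
by apply: eq_fsbigr => A /set_mem[BBA _ _ _]; rewrite (@average_cst _ 1)// mulr1.
Qed.

(** On the sub-balls of one ball, [u] is an affine function of [v], because the factor depends on
    the parent only. Affine functions commute with averaging since the masses of the sub-balls add
    up. *)
Lemma mean_value_transfer (c u v : set X -> R) :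
  (forall B, BB B -> u B - u B^ = c B^ * (v B - v B^)) ->
  mean_value v -> mean_value u.
Proof.
move=> uv mv B BBB; have [finB _ _ _] := balls_sub hBB BBB.
have -> : \sum_(A \in sub BB B) mass A * u A =
    \sum_(A \in sub BB B) (mass A * (u B - c B * v B) + c B * (mass A * v A)).
  apply: eq_fsbigr => A /set_mem AB; have [BBA _ _ _] := AB.
  have := uv A BBA; rewrite (covers_superballE hBB AB) => uvA.
  by rewrite -[u A](subrK (u B)) uvA; ring.
rewrite fsbig_split//= -mulr_fsuml -mulr_fsumr mass_sub// mv//; ring.
Qed.

(** The values on the sub-balls determine the value at their parent, so agreement on fine balls
    climbs to every ball. *)
Lemma mean_value_eq N u v : mean_value u -> mean_value v ->
  (forall B, BB B -> N <= h B -> u B = v B) -> forall B, BB B -> u B = v B.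
Proof.
move=> mu mv uvN; apply: (ball_height_ind hBB uvN) => B BBB uvB.
apply: (mulfI (lt0r_neq0 (mass_gt0 hBB BBB))).
by rewrite -mu// -mv//; apply: eq_fsbigr => A /set_mem /uvB ->.
Qed.

Lemma average_eq0 w D B : (forall x, ~ D x -> w x = 0) ->
  \int[m]_x w x = 0 -> D `<=` B -> average m w B = 0.
Proof.
move=> w0 intw DB; rewrite /average -Rintegral_support.
  by rewrite intw mulr0.
by move=> x nBx; apply: w0 => /DB.
Qed.

(** Either [B] contains [D], and the average is a multiple of the total integral, or [B], not being
    inside [D], is disjoint from it. *)
Lemma average_off_support w D B x : BB D -> BB B ->
  (forall x, ~ D x -> w x = 0) -> \int[m]_x w x = 0 ->
  B x -> ~ D x -> average m w B = 0.
Proof.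
move=> BBD BBB w0 intw Bx nDx.
have [DB|nDB] := pselect (D `<=` B); first exact: average_eq0 DB.
apply: average_cst => // y By; apply: w0 => Dy.
have [hDB|hBD] := leP (h D) (h B).
  by apply: nDx; exact: (ball_nested hBB BBB BBD hDB By Dy).
by apply: nDB; exact: (ball_nested hBB BBD BBB (ltW hBD) Dy By).
Qed.

End MeanValue.

(** * Uniform consequences of the rate limit *)

Section Rates.
Context {R : realType} {X : pmetricType R}.
Variables (m : {measure set (borel X) -> \bar R}).
Variables (BB : set (set X)) (h : set X -> int).
Hypothesis hBB : ball_hierarchy BB h m.
Variable C : set X -> R.
Hypothesis hC : hierarchical_rates BB h C.
Variable kappa : R.
Hypotheses (kappa_gt0 : 0 < kappa) (hkappa : rate_limit BB h C kappa).
Implicit Types (A B D : set X) (x y : X) (k : int).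

Local Notation ballat := (ballat BB h).
Local Notation lambda := (lambda BB C).

Lemma rate_limit_uniform D e : BB D -> 0 < e -> \forall n \near \oo,
  forall x, D x -> `|lambda (ballat n%:Z x) / C (ballat n%:Z x) - kappa| <= e.
Proof.
move=> BBD e0; have /(_ _ (basis_ball_compact hBB BBD)) := hkappa.2.
move=> /(_ [set q | forall y, D y -> `|q y - kappa| <= e]); apply.
apply/uniform_nbhs; exists [set p | `|p.1 - p.2| < e]; split.
  by rewrite -entourage_ballE; exists e.
by move=> q qD y /qD /=; rewrite distrC => /ltW.
Qed.

(** Once [lambda / C] is at most [2 * kappa], each rate [C] is at least [lambda D / (2 * kappa)].
    Every further level adds at least this amount, so [lambda] grows at least linearly in the
    height, uniformly over [D]. *)
Lemma lambda_uniform D M : BB D -> \forall n \near \oo,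
  forall x, D x -> M <= lambda (ballat n%:Z x).
Proof.
(* Tolerance [kappa] bounds the ratio by [2 * kappa]. Adding [absz (h D)] keeps the balls inside
   [D], so that their [lambda] is at least [lambda D]. *)
move=> BBD; have [n0 _ qD] := rate_limit_uniform BBD kappa_gt0.
pose n1 := (n0 + `|h D|)%N.
have l0 := lambda_gt0 hBB hC BBD.
have step x j : D x ->
    lambda D * (1 + j%:R / (2 * kappa)) <= lambda (ballat (n1 + j)%N%:Z x).
  move=> Dx.
  have Dl n : h D <= n%:Z -> lambda D <= lambda (ballat n%:Z x).
    move=> hDn; apply: (lambda_subset hC) => //; first exact: (ballat_mem hBB).
    exact: (ballat_sub hBB).
  elim: j => [|j IHj].
    by rewrite mul0r addr0 mulr1 addn0; apply: Dl; rewrite /n1; lia.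
  have BBn := ballat_mem hBB (n1 + j.+1)%N%:Z x.
  rewrite (lambda_superball hBB hC BBn) (superball_ballat hBB).
  have -> : (n1 + j.+1)%N%:Z - 1 = (n1 + j)%N%:Z by lia.
  have -> : lambda D * (1 + j.+1%:R / (2 * kappa)) =
      lambda D / (2 * kappa) + lambda D * (1 + j%:R / (2 * kappa)).
    by rewrite -natr1; field; rewrite gt_eqF.
  apply: lerD => //.
  have Cn := rate_gt0 hC BBn.
  have /ler_normlP[_] : `|lambda (ballat (n1 + j.+1)%N%:Z x) /
    C (ballat (n1 + j.+1)%N%:Z x) - kappa| <= kappa.
    by apply: qD => //=; rewrite /n1; lia.
  rewrite lerBlDr ler_pdivrMr// => lC.
  rewrite ler_pdivrMr ?mulr_gt0//.
  have : lambda D <= lambda (ballat (n1 + j.+1)%N%:Z x).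
    by apply: Dl; rewrite /n1; lia.
  by move: lC; set l := lambda (ballat _ _); lra.
have [j Mj] : exists j : nat, M <= lambda D * (1 + j%:R / (2 * kappa)).
  pose r := Num.max 0 (M / lambda D * (2 * kappa)).
  exists (Num.truncn r).+1; rewrite mulrC -ler_pdivrMr//.
  have : M / lambda D <= (Num.truncn r).+1%:R / (2 * kappa).
    rewrite ler_pdivlMr ?mulr_gt0//.
    apply: (@le_trans _ _ r); first by rewrite le_max lexx orbT.
    by rewrite ltW// truncnS_gt.
  lra.
exists (n1 + j)%N => // n /= jn x Dx; apply: le_trans Mj _.
have := step x (n - n1)%N Dx; rewrite subnKC; last by lia.
apply: le_trans; rewrite ler_pM2l// lerD2l ler_pM2r ?invr_gt0 ?mulr_gt0//.
by rewrite ler_nat; lia.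
Qed.

End Rates.

(** * Support, regularity and averages of the Laplacian of a mean-zero function *)

Section LaplacianProfile.
Context {R : realType} {X : pmetricType R}.
Variables (m : {measure set (borel X) -> \bar R}).
Variables (BB : set (set X)) (h : set X -> int).
Hypothesis hBB : ball_hierarchy BB h m.
Variable C : set X -> R.
Hypothesis hC : hierarchical_rates BB h C.
Variables (f : X -> R) (D : set X) (N : int).
Hypothesis BBD : BB D.
Hypothesis f_out : forall x, ~ D x -> f x = 0.
Hypothesis f_fine : fine_constant BB h N f.
Hypothesis (f_int : \int[m]_x f x = 0).
Implicit Types (A B : set X) (x y : X) (k : int).

Local Notation "B ^" := (superball BB B) (at level 2, format "B ^").
Local Notation lambda := (lambda BB C).
Local Notation mass B := (fine (m B)).
Local Notation a := (average m f).
Local Notation b := (ball_laplacian BB C (average m f)).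
Local Notation L := (hierarchical_laplacian BB C m f).

Lemma average_large B : BB B -> D `<=` B -> a B = 0.
Proof. by move=> BBB; exact: average_eq0 f_out f_int. Qed.

Lemma average_fine B x : BB B -> N <= h B -> B x -> a B = f x.
Proof.
move=> BBB NB Bx; apply: (average_cst hBB BBB) => y By.
exact: f_fine NB _ _ By Bx.
Qed.

Lemma ball_laplacian_step B : BB B -> b B - b B^ = lambda B^ * (a B - a B^).
Proof. exact: (ball_laplacian_superball hBB hC BBD average_large). Qed.

Lemma ball_laplacian_large B : BB B -> D `<=` B -> b B = 0.
Proof.
move=> BBB DB; apply: (ball_laplacian_eq0 C _ BBB) => E BBE BE.
exact: average_large (subset_trans DB BE).
Qed.

Lemma laplacian_fine B x : BB B -> N <= h B -> B x -> L x = b B.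
Proof.
move=> BBB NB Bx; apply: (hierarchical_laplacianE hBB C BBB Bx) => E BBE Ex BE.
exact: average_fine BBE (le_trans NB BE) Ex.
Qed.

(** Every ball through [x] has zero average, as it misses [D] or contains it; the Laplacian
    therefore does not spread beyond [D]. *)
Lemma laplacian_out x : ~ D x -> L x = 0.
Proof.
move=> nDx; have BBN := ballat_mem hBB N x; have Nx := ballat_self hBB N x.
rewrite (laplacian_fine BBN _ Nx) ?(height_ballat hBB)//.
apply: (ball_laplacian_eq0 C _ BBN) => E BBE NE.
exact: (average_off_support hBB BBD BBE f_out f_int (NE _ Nx) nDx).
Qed.

Lemma laplacian_fine_constant : fine_constant BB h N L.
Proof.
move=> B BBB NB x y Bx By.
by rewrite (laplacian_fine BBB NB Bx) (laplacian_fine BBB NB By).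
Qed.

Let f_lc : locally_constant f.
Proof. exact: (fine_constant_locally_constant hBB f_fine). Qed.

Lemma laplacian_locally_constant : locally_constant L.
Proof. exact: (fine_constant_locally_constant hBB laplacian_fine_constant). Qed.

Lemma mean_value_ball_laplacian : mean_value m BB b.
Proof.
apply: (mean_value_transfer hBB (c := lambda) (v := a)).
  exact: ball_laplacian_step.
exact: (mean_value_average hBB f_lc).
Qed.

(** Comparing two mean value families on fine balls avoids exchanging the integral with the infinite
    sum that defines the Laplacian. *)
Lemma average_laplacian B : BB B -> average m L B = b B.
Proof.
move: B; apply: (mean_value_eq hBB (N := N)).
- exact: (mean_value_average hBB laplacian_locally_constant).
- exact: mean_value_ball_laplacian.
- move=> B BBB NB; apply: (average_cst hBB BBB) => x Bx.
  exact: laplacian_fine.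
Qed.

Lemma Rintegral_laplacian B : BB B -> \int[m]_(x in B) L x = mass B * b B.
Proof. by move=> BBB; rewrite -(mass_averageE hBB)// average_laplacian. Qed.

Lemma laplacian_SX0 c : SX0 m (fun x => c * L x).
Proof.
split; first split.
- exact: (locally_constant_comp (fun r => c * r) laplacian_locally_constant).
- apply: (subclosed_compact _ (basis_ball_compact hBB BBD)).
    exact: closed_closure.
  (* A ball of height [h D] meeting [D] is contained in [D], so the ball of that height around a
     point off [D] is a neighbourhood inside the complement. *)
  have cD : closed D.
    rewrite -[D]setCK; apply: open_closedC; rewrite openE => x nDx.
    have BBx := ballat_mem hBB (h D) x; have xx := ballat_self hBB (h D) x.
    apply: filterS (basis_ball_nbhs hBB BBx xx) => y xy Dy; apply: nDx.
    apply: (ball_nested hBB BBx BBD _ xy Dy) xx.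
    by rewrite (height_ballat hBB).
  rewrite [X in _ `<=` X]((closure_id D).1 cD); apply: closure_subset => x.
  apply: contraPP => /laplacian_out Lx0.
  by rewrite /= Lx0 mulr0 eqxx.
- rewrite (Rintegral_support m (D := D)); last first.
    by move=> x /laplacian_out ->; rewrite mulr0.
  rewrite RintegralZl ?Rintegral_laplacian ?ball_laplacian_large ?mulr0//.
    exact: (basis_ball_measurable hBB).
  exact: (locally_constant_integrable hBB BBD laplacian_locally_constant).
Qed.

End LaplacianProfile.

(** * Generations of sub-balls of a ball *)

Section Levels.
Context {R : realType} {X : pmetricType R}.
Variables (m : {measure set (borel X) -> \bar R}).
Variables (BB : set (set X)) (h : set X -> int).
Hypothesis hBB : ball_hierarchy BB h m.
Implicit Types (A B D : set X) (x y : X) (j : nat) (w : X -> R).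

Local Notation "B ^" := (superball BB B) (at level 2, format "B ^").
Local Notation ballat := (ballat BB h).

(** Each generation is a finite partition of [D]; summing generation by generation turns a sum over
    the tree below [D] into a series. *)
Definition level D j : set (set X) :=
  [set B | [/\ BB B, B `<=` D & h B = h D + j%:Z]].

Lemma finite_level D j : BB D -> finite_set (level D j).
Proof.
move=> BBD; elim: j => [|j IHj].
  apply: (@sub_finite_set _ _ [set D]); last exact: finite_set1.
  move=> B [BBB BD]; rewrite addr0 => hBD.
  have [x Bx] := basis_ball_nonempty hBB BBB.
  exact: (eq_height_ball hBB BBB BBD hBD Bx (BD _ Bx)).
apply: (@sub_finite_set _ _ (\bigcup_(B in level D j) sub BB B)); last first.
  by apply: bigcup_finite => // B [BBB _ _]; have [] := balls_sub hBB BBB.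
move=> B [BBB BD hB]; have BB' := superball_mem hBB BBB.
exists B^; last exact: (covers_superball hBB BBB).
have hB' : h B^ = h D + j%:Z by rewrite (height_superball hBB BBB) hB; lia.
split => //; have [x Bx] := basis_ball_nonempty hBB BBB.
apply: (ball_nested hBB BB' BBD _ (subset_superball hBB BBB Bx) (BD _ Bx)).
by rewrite hB'; lia.
Qed.

Lemma trivIset_level D j : trivIset (level D j) id.
Proof.
move=> A B [BBA _ hA] [BBB _ hB] [x [/= Ax Bx]].
by apply: (eq_height_ball hBB BBA BBB _ Ax Bx); rewrite hA hB.
Qed.

Lemma trivIset_levels D : trivIset setT (level D).
Proof.
by move=> i j _ _ [B [[_ _ hi] [_ _ hj]]]; move: hj; rewrite hi; lia.
Qed.

Lemma bigcup_level D j : BB D -> \bigcup_(A in level D j) A = D.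
Proof.
move=> BBD; apply/seteqP; split => [x [A [_ AD _] /AD]//|x Dx].
exists (ballat (h D + j%:Z) x); last exact: (ballat_self hBB).
split; [exact: (ballat_mem hBB)| |exact: (height_ballat hBB)].
by apply: (ballat_sub hBB BBD Dx); lia.
Qed.

Lemma bigcup_levels D : BB D ->
  \bigcup_j level D j = [set B | BB B /\ B `<=` D].
Proof.
move=> BBD; apply/seteqP; split => [B [j _ [BBB BD _]]//|B [BBB BD]].
have := subset_height hBB BBB BBD BD => hDB.
by exists `|h B - h D|%N => //; split => //; lia.
Qed.

Lemma Rintegral_level w D j : BB D -> locally_constant w ->
  \sum_(A \in level D j) \int[m]_(x in A) w x = \int[m]_(x in D) w x.
Proof.
move=> BBD wl; apply: (Rintegral_partition hBB BBD wl).
- exact: finite_level.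
- by move=> A [].
- exact: trivIset_level.
- exact: bigcup_level.
Qed.

Lemma cvg_Rintegral_ball (u : nat -> X -> R) w D : BB D ->
  (forall n, locally_constant (u n)) -> locally_constant w ->
  (forall e, 0 < e ->
    \forall n \near \oo, forall x, D x -> `|u n x - w x| <= e) ->
  \int[m]_(x in D) u n x @[n --> \oo] --> \int[m]_(x in D) w x.
Proof.
move=> BBD ul wl uw; have mD := mass_gt0 hBB BBD.
apply/cvgrPdist_le => e e0.
have /uw : 0 < e / fine (m D) by rewrite divr_gt0.
apply: filterS => n une; rewrite distrC -RintegralB.
- rewrite -[e](@divfK _ (fine (m D))) ?gt_eqF//.
  apply: (Rintegral_ball_le hBB BBD _ une).
  exact: (locally_constant_comp2 (fun r s => r - s)).
- exact: (basis_ball_measurable hBB).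
- exact: (locally_constant_integrable hBB).
- exact: (locally_constant_integrable hBB).
Qed.

End Levels.

(** * Telescoping of the energy *)

Section Energy.
Context {R : realType} {X : pmetricType R}.
Variables (m : {measure set (borel X) -> \bar R}).
Variables (BB : set (set X)) (h : set X -> int).
Hypothesis hBB : ball_hierarchy BB h m.
Variable W : set X -> set X -> R.
Hypothesis W_gt0 : forall B, BB B -> 0 < W B (superball BB B).
Hypothesis W_sym : forall B, BB B -> W (superball BB B) B = W B (superball BB B).
Implicit Types (A B D : set X) (x y : X) (phi : set X -> R).

Local Notation "B ^" := (superball BB B) (at level 2, format "B ^").
Local Notation ballat := (ballat BB h).

Let edge_energy phi B : R := `|phi B - phi B^| ^+ 2 * W B B^.

Let edge_energy_ge0 phi B : BB B -> (0 <= (edge_energy phi B)%:E)%E.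
Proof. by move=> BBB; rewrite lee_fin mulr_ge0 ?sqr_ge0 ?ltW ?W_gt0. Qed.

Let edge_energy_flux phi B :
  edge_energy phi B = flux BB W phi B * (phi B - phi B^).
Proof. by rewrite /edge_energy /flux real_normK ?num_real//; ring. Qed.

(** Every edge gives two ordered pairs, one per orientation. The two classes are disjoint: a ball
    that is the super-ball of its own super-ball would have a height differing from itself by
    two. *)
Lemma esum_edges (F : set X * set X -> \bar R) :
  (forall A B, adjacent_balls BB A B -> (0 <= F (A, B))%E) ->
  (\esum_(e in [set e | adjacent_balls BB e.1 e.2]) F e =
   \esum_(B in BB) F (B, B^) + \esum_(B in BB) F (B^, B))%E.
Proof.
move=> F0; rewrite (esumID [set e | BB e.1 /\ e.2 = e.1^]); last first.
  by move=> [A B]; exact: F0.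
congr (_ + _)%E.
  apply: (@reindex_esum _ _ _ BB _ (fun B => (B, B^)) F); split.
  - move=> B BBB; have BB' := superball_mem hBB BBB.
    by split; split => //=; left.
  - by move=> A B _ _ [].
  - by move=> [A B] [_ [/= BBA ->]]; exists A.
apply: (@reindex_esum _ _ _ BB _ (fun B => (B^, B)) F); split.
- move=> B BBB; have BB' := superball_mem hBB BBB.
  split; first by split => //=; right.
  move=> [_ /= /(congr1 h)].
  by rewrite (height_superball hBB BB') (height_superball hBB BBB); lia.
- by move=> A B _ _ [].
- move=> [A B] /= [[/= BBA BBB [BA|AB]] nAB].
    by exfalso; apply: nAB.
  by exists B => //=; rewrite AB.
Qed.

Lemma energy_esum phi :
  energy BB W phi = (\esum_(B in BB) (edge_energy phi B)%:E)%E.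
Proof.
rewrite /energy esum_edges; last first.
  move=> A B [BBA BBB [->|->]]; rewrite lee_fin/= mulr_ge0 ?sqr_ge0//.
    by rewrite ltW ?W_gt0.
  by rewrite W_sym// ltW ?W_gt0.
rewrite [X in (_ * (_ + X))%E](_ : _ = \esum_(B in BB) (edge_energy phi B)%:E)%E.
  by rewrite -mule2n -mule_natl muleA -EFinM mulVf ?mul1e.
by apply: eq_esum => B BBB /=; rewrite W_sym// distrC.
Qed.

Lemma energy_cvg phi g D (E : R) : BB D -> locally_constant g ->
  (forall B, BB B -> flux BB W phi B = \int[m]_(x in B) g x) ->
  (forall B, BB B -> ~ B `<=` D -> flux BB W phi B = 0) ->
  phi D^ = 0 ->
  \int[m]_(x in D) (g x * phi (ballat n%:Z x)) @[n --> \oo] --> E ->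
  energy BB W phi = E%:E.
Proof.
move=> BBD glc phig phi_out phiD' gphi.
have lc k : locally_constant (fun x => g x * phi (ballat k x)).
  apply: (locally_constant_comp2 (fun r s => r * s)) => //.
  exact: (locally_constant_ballat hBB).
pose I k := \int[m]_(x in D) (g x * phi (ballat k x)).
(* On a ball [A] of generation [j] the difference of the integrands is [g] times the constant
   [phi A - phi A^]. Its integral is flux times increment, which is the energy of the edge above
   [A]. *)
have energy_level j : (\esum_(B in level BB h D j) (edge_energy phi B)%:E)%E =
    (I (h D + j%:Z) - I (h D + j%:Z - 1))%:E.
  have finj := finite_level hBB j BBD.
  rewrite esum_fset//; last first.
    by move=> B /set_mem[BBB _ _]; exact: edge_energy_ge0.
  rewrite fsumEFin//; congr (_%:E).
  have gphi_int B k : BB B ->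
      m.-integrable (B : set (borel X))
        (EFin \o (fun x => g x * phi (ballat k x))).
    by move=> BBB; apply: (locally_constant_integrable hBB BBB); exact: lc.
  rewrite /I -RintegralB; [|exact: (basis_ball_measurable hBB BBD)|
    exact: gphi_int|exact: gphi_int].
  rewrite -(Rintegral_level hBB j BBD); last first.
    exact: (locally_constant_comp2 (fun r s => r - s) (lc _) (lc _)).
  apply: eq_fsbigr => A /set_mem[BBA AD hA].
  rewrite (@eq_Rintegral _ _ _ _ _
    (fun x : borel X => g x * (phi A - phi A^))); last first.
    move=> x /set_mem Ax; rewrite mulrBr; congr (_ * phi _ - _ * phi _).
      by rewrite -hA (ballatE hBB BBA Ax).
    by rewrite -(superball_ballat hBB) -hA (ballatE hBB BBA Ax).
  rewrite RintegralZr; first last.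
  - exact: (locally_constant_integrable hBB BBA glc).
  - exact: (basis_ball_measurable hBB BBA).
  by rewrite -phig// edge_energy_flux.
rewrite energy_esum.
(* The edges above balls not inside [D] carry no flux, hence no energy. *)
have -> : (\esum_(B in BB) (edge_energy phi B)%:E =
    \esum_(B in \bigcup_j level BB h D j) (edge_energy phi B)%:E)%E.
  rewrite (bigcup_levels hBB BBD) esum_mkcond [RHS]esum_mkcond.
  apply: eq_esum => B _.
  case: ifPn => [/set_mem BBB|/negP nBB]; last first.
    by rewrite memNset// => -[BBB _]; apply: nBB; exact: mem_set.
  have [BD|nBD] := pselect (B `<=` D); first by rewrite mem_set.
  rewrite memNset; last by move=> -[].
  by rewrite edge_energy_flux phi_out ?mul0r.
rewrite esum_bigcup; last 2 first.
- by apply: (@sub_trivIset _ _ _ setT) => //; exact: trivIset_levels.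
- by move=> B [j _ [BBB _ _]]; exact: edge_energy_ge0.
rewrite -nneseries_esumT; last first.
  by move=> j; apply: esum_ge0 => B [BBB _ _]; exact: edge_energy_ge0.
apply: cvg_lim => //.
(* Generation [0] is the single edge from [D] to [D^], where [phi] vanishes, so the telescoping
   starts from zero. *)
have I0 : I (h D - 1) = 0.
  apply: Rintegral_eq0 => x Dx.
  by rewrite -(superball_ballat hBB) (ballatE hBB BBD Dx) phiD' mulr0.
(* The first [n] generations end at height [h D + n - 1], whence the shift. *)
rewrite (_ : (fun n => _) = (fun n => (I (h D + n%:Z - 1))%:E)); last first.
  apply/funext; elim=> [|n IHn]; first by rewrite big_geq// addr0 I0.
  rewrite big_nat_recr//= IHn energy_level -EFinD; congr (_%:E).
  by rewrite addrC subrK; congr I; lia.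
apply: cvg_EFin; first by apply: nearW.
apply/cvgrPdist_le => e e0.
move/cvgrPdist_le : gphi => /(_ e e0)[n0 _ gphin].
exists (n0 + absz (h D) + 1)%N => // n /= n0n.
have -> : h D + n%:Z - 1 = (absz (h D + n%:Z - 1)%R)%:Z by lia.
by apply: gphin => /=; lia.
Qed.

End Energy.

(** * Flux through an edge and harmonicity *)

Section Flux.
Context {R : realType} {X : pmetricType R}.
Variables (m : {measure set (borel X) -> \bar R}).
Variables (BB : set (set X)) (h : set X -> int).
Hypothesis hBB : ball_hierarchy BB h m.
Variable C : set X -> R.
Hypothesis hC : hierarchical_rates BB h C.
Variable kappa : R.
Hypothesis kappa_gt0 : 0 < kappa.
Variable W : set X -> set X -> R.
Hypothesis hW : is_edge_weight BB C m W kappa.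
Implicit Types (A B : set X) (x y : X) (phi : set X -> R).

Local Notation "B ^" := (superball BB B) (at level 2, format "B ^").
Local Notation lambda := (lambda BB C).
Local Notation mass B := (fine (m B)).

Lemma edge_weightE B : BB B ->
  W B B^ = kappa^-1 * (mass B * lambda B * lambda B^ / C B).
Proof. by move=> /hW[]. Qed.

Lemma edge_weight_gt0 B : BB B -> 0 < W B B^.
Proof.
move=> BBB; rewrite edge_weightE// mulr_gt0 ?invr_gt0// divr_gt0 ?(rate_gt0 hC)//.
rewrite !mulr_gt0 ?(mass_gt0 hBB) ?(lambda_gt0 hBB hC)//.
exact: (superball_mem hBB).
Qed.

(* [1 / lambda(B') - 1 / lambda(B) = C(B) / (lambda(B) lambda(B'))] because
   [C(B) = lambda(B) - lambda(B')]. *)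
Lemma flux_potential phi B v : BB B ->
  kappa * flux BB W phi B = mass B * v <->
  phi B - phi B^ = v / lambda B^ - v / lambda B.
Proof.
move=> BBB; have BB' := superball_mem hBB BBB.
have l0 := lambda_gt0 hBB hC BBB; have l'0 := lambda_gt0 hBB hC BB'.
have C0 := rate_gt0 hC BBB; have m0 := mass_gt0 hBB BBB.
have -> : kappa * flux BB W phi B =
    mass B * (lambda B * lambda B^ / C B * (phi B - phi B^)).
  by rewrite /flux edge_weightE//; field; rewrite !gt_eqF.
have CE : C B = lambda B - lambda B^.
  by rewrite (lambda_superball hBB hC BBB) addrK.
have -> : v / lambda B^ - v / lambda B = C B / (lambda B * lambda B^) * v.
  by rewrite CE; field; rewrite !gt_eqF.
split=> [/(mulfI (lt0r_neq0 m0)) <-|->]; field; rewrite !gt_eqF//.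
Qed.

(** By additivity of the integral, the fluxes through the lower edges of [B] add up to the flux
    through its upper edge, which is Kirchhoff's law at [B]. *)
Lemma flux_density_harmonic phi g :
  flux_density BB m W phi g -> Defs.harmonic BB W phi.
Proof.
move=> [[[glc _] _] phig] B BBB; rewrite /tree_laplacian.
have -> : \sum_(A \in sub BB B) W A B * (phi A - phi B) = flux BB W phi B.
  rewrite phig// -(Rintegral_sub hBB BBB glc); apply: eq_fsbigr => A /set_mem AB.
  have [BBA _ _ _] := AB.
  by rewrite -phig// /flux (covers_superballE hBB AB).
by rewrite /flux; ring.
Qed.

End Flux.

(** * The explicit solution, its normal derivative and its energy *)

Section Solution.
Context {R : realType} {X : pmetricType R}.
Variables (m : {measure set (borel X) -> \bar R}).
Variables (BB : set (set X)) (h : set X -> int).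
Hypothesis hBB : ball_hierarchy BB h m.
Variable C : set X -> R.
Hypothesis hC : hierarchical_rates BB h C.
Variable kappa : R.
Hypotheses (kappa_gt0 : 0 < kappa) (hkappa : rate_limit BB h C kappa).
Variable W : set X -> set X -> R.
Hypothesis hW : is_edge_weight BB C m W kappa.
Variables (f : X -> R) (D : set X) (N : int).
Hypothesis BBD : BB D.
Hypothesis f_out : forall x, ~ D x -> f x = 0.
Hypothesis f_fine : fine_constant BB h N f.
Hypothesis (f_int : \int[m]_x f x = 0).
Implicit Types (A B : set X) (x y : X) (k : int) (phi : set X -> R).

Local Notation "B ^" := (superball BB B) (at level 2, format "B ^").
Local Notation ballat := (ballat BB h).
Local Notation lambda := (lambda BB C).
Local Notation a := (average m f).
Local Notation b := (ball_laplacian BB C (average m f)).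
Local Notation L := (hierarchical_laplacian BB C m f).

Definition solution B : R := a B - b B / lambda B.

Let L_lc : locally_constant L.
Proof. exact: (laplacian_locally_constant hBB C f_fine). Qed.

Let f_lc : locally_constant f.
Proof. exact: (fine_constant_locally_constant hBB f_fine). Qed.

Let L_out x : ~ D x -> L x = 0.
Proof. exact: (laplacian_out hBB C BBD f_out f_fine f_int). Qed.

Let lambda_neq0 B : BB B -> lambda B != 0.
Proof. by move=> /(lambda_gt0 hBB hC)/lt0r_neq0. Qed.

Lemma solution_flux_density :
  flux_density BB m W solution (fun x => kappa^-1 * L x).
Proof.
split; first exact: (laplacian_SX0 hBB hC BBD f_out f_fine f_int).
move=> B BBB; rewrite RintegralZl; first last.
- exact: (locally_constant_integrable hBB BBB L_lc).
- exact: (basis_ball_measurable hBB BBB).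
rewrite (Rintegral_laplacian hBB hC BBD f_out f_fine f_int BBB).
apply: (mulfI (lt0r_neq0 kappa_gt0)); rewrite mulVKf ?gt_eqF//.
apply/(flux_potential hBB hC kappa_gt0 hW _ _ BBB); rewrite /solution.
have BB' := superball_mem hBB BBB.
have := ball_laplacian_step hBB hC BBD f_out f_int BBB => bB.
(* This is the martingale identity solved for [a B]; the term [b B^ / lambda B^] then cancels the
   correction at [B^]. *)
have -> : a B = a B^ + (b B - b B^) / lambda B^.
  by rewrite bB mulrC mulKf ?lambda_neq0// addrC subrK.
by field; rewrite !lambda_neq0.
Qed.

Lemma solution_fine k x : N <= k ->
  solution (ballat k x) = f x - L x / lambda (ballat k x).
Proof.
move=> Nk; have BBk := ballat_mem hBB k x; have kx := ballat_self hBB k x.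
have hk : N <= h (ballat k x) by rewrite (height_ballat hBB).
rewrite /solution (average_fine hBB f_fine BBk hk kx).
by rewrite (laplacian_fine hBB C f_fine BBk hk kx).
Qed.

Let ratio_lc k : locally_constant (fun x => L x / lambda (ballat k x)).
Proof.
apply: (locally_constant_comp2 (fun r s => r / s)) => //.
exact: (locally_constant_ballat hBB k lambda).
Qed.

Lemma laplacian_ratio_uniform e : 0 < e -> \forall n \near \oo,
  forall x, D x -> `|L x / lambda (ballat n%:Z x)| <= e.
Proof.
move=> e0; have [M LM] := locally_constant_bounded hBB BBD L_lc.
have := lambda_uniform hBB hC kappa_gt0 hkappa (M / e) BBD.
apply: filterS => n lM x Dx.
have l0 := lambda_gt0 hBB hC (ballat_mem hBB n%:Z x).
rewrite normrM normfV (gtr0_norm l0) ler_pdivrMr//.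
apply: le_trans (LM x Dx) _; rewrite mulrC -ler_pdivrMr//.
exact: lM.
Qed.

Let near_fine : \forall n \near \oo, N <= n%:Z.
Proof. by exists `|N|%N => // n /= Nn; lia. Qed.

Lemma solution_trace : trace BB h m solution f.
Proof.
have solE n x : N <= n%:Z ->
    solution (ballat n%:Z x) = f x - L x / lambda (ballat n%:Z x).
  exact: solution_fine.
apply: (cvgL2_uniform hBB BBD) => //.
- apply: filterS near_fine => n Nn; split.
    rewrite (_ : (fun x => _) = fun x => f x - L x / lambda (ballat n%:Z x)).
      exact: (locally_constant_comp2 (fun r s => r - s) f_lc (ratio_lc n%:Z)).
    by apply/funext => x; exact: solE.
  by move=> x nDx; rewrite solE// f_out// L_out// mul0r subrr.
- move=> e e0; apply: filterS2 near_fine (laplacian_ratio_uniform e0).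
  by move=> n Nn Le x Dx; rewrite solE// addrAC subrr sub0r normrN; exact: Le.
Qed.

Lemma solution_large B : BB B -> D `<=` B -> solution B = 0.
Proof.
move=> BBB DB; rewrite /solution (ball_laplacian_large C f_out f_int BBB DB).
by rewrite (average_large f_out f_int BBB DB) mul0r subrr.
Qed.

(** Along the ascending chain at [x] the potential is eventually equal to [0], namely once the ball
    contains a common super-ball [E] of [D] and of a ball around [x]. *)
Lemma solution_vanishes : vanishes_at_infinity BB h solution.
Proof.
move=> x; have BB0 := ballat_mem hBB 0 x.
have [E [BBE DE xE _ _]] := balls_common hBB BBD BB0.
apply: cvg_near_cst; exists `|h E|%N => // n /= hEn.
apply/solution_large; first exact: (ballat_mem hBB).
apply: subset_trans DE _.
apply: (ball_nested hBB BBE (ballat_mem hBB _ x) _ _ (ballat_self hBB _ x)).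
  by rewrite (height_ballat hBB); lia.
exact/xE/(ballat_self hBB).
Qed.

Lemma canonical_solutionP : canonical_solution BB h m W f solution.
Proof.
have hf := flux_density_harmonic hBB solution_flux_density.
split; split => //.
- by exists f; exact: solution_trace.
- by eexists; exact: solution_flux_density.
- exact: solution_trace.
- exact: solution_vanishes.
Qed.

Let rate_ratio_lc k :
  locally_constant (fun x => lambda (ballat k x) / C (ballat k x)).
Proof. exact: (locally_constant_ballat hBB k (fun B => lambda B / C B)). Qed.

Lemma normal_derivative phi : (forall B, BB B -> phi B = solution B) ->
  cvgL2 m (fun n x => normal_quotient BB h m W f phi n%:Z x) L.
Proof.
move=> phiE.
(* The difference of [f] and [phi] at the parent ball is [L x] over the [lambda] of that ball, which
   cancels the same factor in the weight. The bound on [n%:Z - 1] makes the parent fine enough for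
   [solution_fine]. *)
have quotE n x : N <= n%:Z - 1 -> normal_quotient BB h m W f phi n%:Z x =
    kappa^-1 * (lambda (ballat n%:Z x) / C (ballat n%:Z x)) * L x.
  move=> Nn; have BBn := ballat_mem hBB n%:Z x.
  have BBn1 := ballat_mem hBB (n%:Z - 1) x.
  rewrite /normal_quotient phiE// solution_fine// -(superball_ballat hBB).
  rewrite (edge_weightE hW BBn) (superball_ballat hBB).
  by field; rewrite !lambda_neq0// !gt_eqF// ?(rate_gt0 hC)// (mass_gt0 hBB).
have near_fine1 : \forall n \near \oo, N <= n%:Z - 1.
  by exists (absz N + 1)%N => // n /= Nn; lia.
apply: (cvgL2_uniform hBB BBD) => //.
- apply: filterS near_fine1 => n Nn; split.
    rewrite (_ : (fun x => _) = fun x =>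
      kappa^-1 * (lambda (ballat n%:Z x) / C (ballat n%:Z x)) * L x).
      exact: (locally_constant_comp2 (fun r s => kappa^-1 * r * s)
        (rate_ratio_lc n%:Z) L_lc).
    by apply/funext => x; exact: quotE.
  by move=> x nDx; rewrite quotE// L_out// mulr0.
- move=> e e0; have [M LM] := locally_constant_bounded hBB BBD L_lc.
  pose M1 := Num.max M 1.
  have M10 : 0 < M1 by rewrite lt_max ltr01 orbT.
  (* The error is [(q - kappa) * (kappa^-1 * L x)], so with [M1] bounding [L] this tolerance yields
     [e]. The maximum with [1] makes [M1] positive. *)
  have d0 : 0 < e * kappa / M1 by rewrite divr_gt0 ?mulr_gt0.
  apply: filterS2 near_fine1 (rate_limit_uniform hBB hkappa BBD d0).
  move=> n Nn qn x Dx; rewrite quotE//.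
  have := qn x Dx; set q := _ / C _ => qk.
  have -> : kappa^-1 * q * L x - L x = (q - kappa) * (kappa^-1 * L x).
    by field; rewrite gt_eqF.
  rewrite normrM normrM normfV (gtr0_norm kappa_gt0).
  have LM1 : `|L x| <= M1 by apply: le_trans (LM x Dx) _; rewrite le_max lexx.
  apply: (@le_trans _ _ (e * kappa / M1 * (kappa^-1 * M1))).
    apply: ler_pM => //; first by rewrite mulr_ge0 ?invr_ge0// ltW.
    by rewrite ler_pM2l ?invr_gt0.
  by rewrite le_eqVlt; apply/orP; left; apply/eqP; field; rewrite !gt_eqF.
Qed.

Lemma solution_energy phi g : (forall B, BB B -> phi B = solution B) ->
  flux_density BB m W phi g -> (forall x, g x = kappa^-1 * L x) ->
  energy BB W phi = (kappa^-1 * \int[m]_x (f x * L x))%:E.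
Proof.
move=> phiE [[[g_lc _] g_int] phig] gE.
have g_out x : ~ D x -> g x = 0 by move=> nDx; rewrite gE L_out// mulr0.
apply: (energy_cvg hBB (edge_weight_gt0 hBB hC kappa_gt0 hW) _ BBD g_lc phig).
- by move=> B /hW[].
(* A ball not inside [D] contains a point off [D], so [g], supported in [D] with integral zero, has
   zero average on it. *)
- move=> B BBB nBD; have [x Bx nDx] : exists2 x, B x & ~ D x.
    apply: contrapT => nex; apply: nBD => x Bx; apply: contrapT => nDx.
    by apply: nex; exists x.
  rewrite phig// -(mass_averageE hBB _ BBB).
  by rewrite (average_off_support hBB BBD BBB g_out g_int Bx nDx) mulr0.
- have BBD' := superball_mem hBB BBD.
  by rewrite phiE// solution_large//; exact: (subset_superball hBB).
have -> : kappa^-1 * \int[m]_x (f x * L x) = \int[m]_(x in D) (g x * f x).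
  rewrite (Rintegral_support m (D := D)); last first.
    by move=> x /f_out ->; rewrite mul0r.
  rewrite -RintegralZl; first by apply: eq_Rintegral => x _; rewrite gE; ring.
    exact: (basis_ball_measurable hBB BBD).
  apply: (locally_constant_integrable hBB BBD).
  exact: (locally_constant_comp2 (fun r s => r * s)).
apply: (cvg_Rintegral_ball hBB BBD).
- move=> n; apply: (locally_constant_comp2 (fun r s => r * s)) => //.
  exact: (locally_constant_ballat hBB).
- exact: (locally_constant_comp2 (fun r s => r * s)).
move=> e e0; have [M gM] := locally_constant_bounded hBB BBD g_lc.
pose M1 := Num.max M 1.
have M10 : 0 < M1 by rewrite lt_max ltr01 orbT.
have d0 : 0 < e / M1 by rewrite divr_gt0.
apply: filterS2 near_fine (laplacian_ratio_uniform d0) => n Nn Le x Dx.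
rewrite phiE ?solution_fine//; last exact: (ballat_mem hBB).
rewrite -mulrBr addrAC subrr sub0r mulrN normrN normrM.
rewrite -[e](@divfK _ M1) ?gt_eqF// mulrC.
apply: ler_pM => //; first exact: Le.
by apply: le_trans (gM x Dx) _; rewrite le_max lexx.
Qed.

End Solution.

(** * Identification of every canonical solution *)

Section Canonical.
Context {R : realType} {X : pmetricType R}.
Variables (m : {measure set (borel X) -> \bar R}).
Variables (BB : set (set X)) (h : set X -> int).
Hypothesis hBB : ball_hierarchy BB h m.
Variable C : set X -> R.
Hypothesis hC : hierarchical_rates BB h C.
Variable kappa : R.
Hypotheses (kappa_gt0 : 0 < kappa) (hkappa : rate_limit BB h C kappa).
Variable W : set X -> set X -> R.
Hypothesis hW : is_edge_weight BB C m W kappa.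
Implicit Types (A B : set X) (x y : X) (k : int) (phi : set X -> R).

Local Notation "B ^" := (superball BB B) (at level 2, format "B ^").
Local Notation ballat := (ballat BB h).
Local Notation lambda := (lambda BB C).

(* On small balls [psi B + avg B / lambda B] is locally constant and differs
   from [psi] by a quantity tending to [0], hence equals the trace of [psi]. *)
Lemma trace_potential (f g : X -> R) (psi avg : set X -> R) N :
  fine_constant BB h N f -> fine_constant BB h N g ->
  (forall B, BB B -> psi B - psi B^ = avg B / lambda B^ - avg B / lambda B) ->
  (forall B x, BB B -> N <= h B -> B x -> avg B = g x) ->
  trace BB h m psi f ->
  forall B x, BB B -> N <= h B -> B x -> psi B + avg B / lambda B = f x.
Proof.
move=> f_fine g_fine psi_step avg_fine psi_f B x BBB NB Bx.
(* Going down from [B] towards [y], each increment of [psi] is compensated by that of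
   [avg / lambda], since [avg] keeps the value [g x] there. *)
have psiE n y : h B <= n%:Z -> B y ->
    psi (ballat n%:Z y) + g x / lambda (ballat n%:Z y) =
    psi B + avg B / lambda B.
  move=> hBn By; have -> : n%:Z = h B + `|n%:Z - h B|%N%:Z by lia.
  elim: (`|n%:Z - h B|)%N => [|j <-].
    by rewrite addr0 (ballatE hBB BBB By) (avg_fine B x).
  set k := h B + j.+1%:Z.
  have BBk := ballat_mem hBB k y; have ky := ballat_self hBB k y.
  have k'E : (ballat k y)^ = ballat (h B + j%:Z) y.
    by rewrite (superball_ballat hBB); congr Defs.ballat; rewrite /k; lia.
  have gk : avg (ballat k y) = g x.
    rewrite (avg_fine _ y BBk _ ky); first exact: (g_fine B).
    by rewrite (height_ballat hBB) /k; lia.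
  have := psi_step _ BBk; rewrite k'E gk => psik.
  by rewrite -[psi (ballat k y)](subrK (psi (ballat (h B + j%:Z) y))) psik; ring.
apply/eqP; rewrite -subr_eq0; apply/negP => /negP ne0.
set c := psi B + avg B / lambda B - f x in ne0.
have e0 : 0 < `|c| / 2 by rewrite divr_gt0// normr_gt0.
have near_hB : \forall n \near \oo, h B <= n%:Z.
  by exists `|h B|%N => // n /= Nn; lia.
have lam := lambda_uniform hBB hC kappa_gt0 hkappa (`|g x| / (`|c| / 2)) BBB.
(* One large height gives both a point [y] of [B] where [psi] is closer than half of [|c|] to [f],
   and a [lambda] making the correction at most the other half. As [f y = f x], this contradicts the
   definition of [c]. *)
have [n /= [[hBn [y By psif]] /(_ y By)]] :=
  filter_ex (filterI (filterI near_hB (cvgL2_ball_ex hBB BBB e0 psi_f)) lam).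
have l0 := lambda_gt0 hBB hC (ballat_mem hBB n%:Z y).
rewrite ler_pdivrMr// mulrC -ler_pdivrMr// -(gtr0_norm l0) -normf_div => gl.
have : `|c| < `|c| / 2 + `|c| / 2.
  apply: le_lt_trans (ltr_leD psif gl); apply: le_trans (ler_normD _ _).
  by rewrite /c -(psiE n y hBn By) (f_fine B BBB NB x y Bx By) addrAC.
by rewrite -splitr ltxx.
Qed.

Lemma canonical_solution_unique (f g : X -> R) psi : SX0 m f ->
  flux_density BB m W psi g -> trace BB h m psi f ->
  (forall B, BB B -> psi B = solution m BB C f B) /\
  (forall x, g x = kappa^-1 * hierarchical_laplacian BB C m f x).
Proof.
move=> [fS f_int] [[gS g_int] psig] psi_f.
have [D [N1 [BBD f_out f_fine]]] := SX_fine_constant hBB fS.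
have [E [N2 [BBE g_out g_fine]]] := SX_fine_constant hBB gS.
pose N := Num.max N1 N2.
have {}f_fine : fine_constant BB h N f.
  by move=> B BBB; rewrite ge_max => /andP[+ _]; exact: f_fine.
have {}g_fine : fine_constant BB h N g.
  by move=> B BBB; rewrite ge_max => /andP[_]; exact: g_fine.
(* The factor [kappa] is that of [flux_potential], which then turns the flux identity into the
   increment formula [psi_step]. *)
pose avg B := kappa * average m g B.
have psi_step B : BB B -> psi B - psi B^ = avg B / lambda B^ - avg B / lambda B.
  move=> BBB; apply/(flux_potential hBB hC kappa_gt0 hW _ _ BBB).
  by rewrite psig// -(mass_averageE hBB _ BBB) mulrCA.
have avg_fine B x : BB B -> N <= h B -> B x -> avg B = kappa * g x.
  by move=> BBB NB Bx; rewrite /avg (average_fine hBB g_fine BBB NB Bx).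
have kg_fine : fine_constant BB h N (fun x => kappa * g x).
  by move=> B BBB NB x y Bx By; rewrite (g_fine B BBB NB x y Bx By).
have psif := trace_potential f_fine kg_fine psi_step avg_fine psi_f.
have f_lc := fine_constant_locally_constant hBB f_fine.
have g_lc := fine_constant_locally_constant hBB g_fine.
pose u B := psi B + avg B / lambda B.
have u_step B : BB B -> u B - u B^ = (lambda B^)^-1 * (avg B - avg B^).
  move=> BBB; rewrite /u -[psi B](subrK (psi B^)) psi_step//.
  by rewrite -/(avg B) -/(avg B^); ring.
have mavg : mean_value m BB avg.
  apply: (mean_value_transfer hBB (c := fun=> kappa) (v := average m g)).
    by move=> B BBB; rewrite -mulrBr.
  exact: (mean_value_average hBB g_lc).
have uE B : BB B -> u B = average m f B.
  move: B; apply: (mean_value_eq hBB (N := N)).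
  - apply: (mean_value_transfer hBB (c := fun B => (lambda B)^-1)) mavg.
    exact: u_step.
  - exact: (mean_value_average hBB f_lc).
  - move=> B BBB NB; have [x Bx] := basis_ball_nonempty hBB BBB.
    by rewrite (average_fine hBB f_fine BBB NB Bx); exact: psif.
(* [F] contains both supports, so both sides vanish on the balls above it; below, the increments
   agree, each being [lambda B^ * (u B - u B^)]. *)
have avgE B : BB B -> avg B = ball_laplacian BB C (average m f) B.
  have [F [BBF DF EF _ _]] := balls_common hBB BBD BBE.
  move: B; apply: (ball_super_ind hBB BBF) => B BBB.
    move=> FB; have DB := subset_trans DF FB.
    rewrite (ball_laplacian_large C f_out f_int BBB DB).
    by rewrite /avg (average_large g_out g_int BBB (subset_trans EF FB)) mulr0.
  move=> avgB'; have BB' := superball_mem hBB BBB.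
  rewrite -[LHS](subrK (avg B^)) avgB'.
  rewrite -[RHS](subrK (ball_laplacian BB C (average m f) B^)).
  congr (_ + _); rewrite (ball_laplacian_step hBB hC BBD f_out f_int BBB).
  rewrite -!uE// u_step// mulVKf ?avgB'//.
  exact/lt0r_neq0/(lambda_gt0 hBB hC BB').
split=> [B BBB|x].
  by rewrite /solution -uE// -avgE// addrK.
(* At height [N] the families [avg] and [ball_laplacian] take the pointwise values [kappa * g x] and
   the Laplacian at [x]. *)
have BBN := ballat_mem hBB N x; have Nx := ballat_self hBB N x.
have hN : N <= h (ballat N x) by rewrite (height_ballat hBB).
rewrite (laplacian_fine hBB C f_fine BBN hN Nx) -avgE// (avg_fine _ x)//.
by rewrite mulKf// gt_eqF.
Qed.

End Canonical.

Theorem theorem1p4 (R : realType) (X : pmetricType R)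
    (hU : ultrametric (X := X))
    (hnc : ~ compact [set: X]) (hlc : locally_compact [set: X])
    (hsep : separable (X := X)) (hperf : perfect_set [set: X])
    (m : {measure set (borel X) -> \bar R})
    (hrad : radon m) (hna : non_atomic m) (hfs : full_support m)
    (hinf : m [set: X] = +oo%E)
    (BB : set (set X)) (h : set X -> int) (hBB : ball_hierarchy BB h m)
    (C : set X -> R) (hC : hierarchical_rates BB h C)
    (kappa : R) (hkappa0 : 0 < kappa) (hkappa : rate_limit BB h C kappa)
    (W : set X -> set X -> R) (hW : is_edge_weight BB C m W kappa)
    (f : X -> R) (hf : SX0 m f) :
  let L := hierarchical_laplacian BB C m in
  (exists phi : set X -> R,
     canonical_solution BB h m W f phi /\
     forall psi : set X -> R, canonical_solution BB h m W f psi ->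
       forall B, BB B -> psi B = phi B) /\
  (forall phi : set X -> R, canonical_solution BB h m W f phi ->
     [/\ forall g : X -> R, flux_density BB m W phi g ->
           forall x, g x = kappa^-1 * L f x,
         cvgL2 m (fun n x => normal_quotient BB h m W f phi n%:Z x) (L f)
       & energy BB W phi = (kappa^-1 * \int[m]_x (f x * L f x))%:E]).
Proof.
move=> L; have [fS f_int] := hf.
have [D [N [BBD f_out f_fine]]] := SX_fine_constant hBB fS.
(* The claims concern an arbitrary canonical solution and any of its flux densities, so both are
   first identified with the explicit ones. *)
have sol_unique psi g : canonical_solution BB h m W f psi ->
    flux_density BB m W psi g ->
    (forall B, BB B -> psi B = solution m BB C f B) /\
    (forall x, g x = kappa^-1 * L f x).
  move=> [_ [_ psi_f _]] psig.
  exact: (canonical_solution_unique hBB hC hkappa0 hkappa hW hf psig psi_f).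
split=> [|phi phiP].
  exists (solution m BB C f); split.
    exact: (canonical_solutionP hBB hC hkappa0 hkappa hW BBD f_out f_fine
      f_int).
  move=> psi psiP B BBB; have [[_ _ [g psig]] _] := psiP.
  by have [-> ] := sol_unique _ _ psiP psig.
have [[_ _ [g phig]] _] := phiP.
have [phiE gE] := sol_unique _ _ phiP phig.
split.
- by move=> g' phig'; have [] := sol_unique _ _ phiP phig'.
- exact: (normal_derivative hBB hC hkappa0 hkappa hW BBD f_out f_fine f_int
    phiE).
- exact: (solution_energy hBB hC hkappa0 hkappa hW BBD f_out f_fine f_int phiE
    phig gE).
Qed.
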